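(* Let $\mathcal{C}=Av(B)$ be a permutation class with basis $B$, containing the permutations $12$ and $21$, and suppose that both $B$ and the set $\mathcal{S}_{\mathcal{C}}$ of simple permutations in $\mathcal{C}$ are finite. There is an algorithm which, given $B$ and $\mathcal{S}_{\mathcal{C}}$ as input, terminates and outputs a combinatorial specification of $\mathcal{C}$, that is, an unambiguous system of combinatorial equations that describes recursively the permutations of $\mathcal{C}$ using only combinatorial constructors (disjoint union, cartesian product, sequence, ...) and permutations of size $1$. The sets described by the equations of this system are restrictions $\hat{\mathcal{C}}^{\varepsilon}\langle E\rangle(A)$, which involve both pattern avoidance and pattern containment constraints, where every permutation in $E$ and $A$ is a pattern of some element of $B$. The specification obtained yields a system of equations satisfied by the generating function of $\mathcal{C}$, and this system is always positive and algebraic. It also yields a (Boltzmann) uniform random sampler of permutations in $\mathcal{C}$.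
   Context: A permutation $\sigma=\sigma_1\cdots\sigma_n$ has size $|\sigma|=n$. A permutation $\pi$ of size $k$ is a pattern of $\sigma$, written $\pi\preceq\sigma$, if some subsequence $\sigma_{i_1}\cdots\sigma_{i_k}$ with $i_1<\cdots<i_k$ is order-isomorphic to $\pi$; then $\sigma$ contains $\pi$, and otherwise $\sigma$ avoids $\pi$. A permutation class is a set of permutations that is a downset for $\preceq$. $Av(B)$ is the set of permutations avoiding every element of $B$. Every class $\mathcal{C}$ is $Av(B)$ for a unique antichain $B$ (for $\preceq$), called the basis of $\mathcal{C}$. An interval of $\sigma$ (of size $n$) is a set of consecutive integers of $\{1,\ldots,n\}$ whose images under $\sigma$ also form a set of consecutive integers. A permutation is simple if it has size at least $4$ and its only intervals are the singletons and $\{1,\ldots,n\}$; thus $1,12,21$ are not called simple. For $\sigma$ of size $n$ and permutations $\pi^1,\ldots,\pi^n$, the substitution $\sigma[\pi^1,\ldots,\pi^n]$ is the permutation of size $|\pi^1|+\cdots+|\pi^n|$ obtained by concatenating sequences $S^1,\ldots,S^n$ of integers such that the integers of each $S^i$ form an interval, $S^i$ is order-isomorphic to $\pi^i$, and $S^i$ consists of integers smaller than those of $S^j$ if and only if $\sigma_i<\sigma_j$. A permutation is $12$-indecomposable (resp. $21$-indecomposable) if it cannot be written as $12[\pi^1,\pi^2]$ (resp. $21[\pi^1,\pi^2]$). Every permutation of size at least $2$ decomposes uniquely as $12[\pi^1,\pi^2]$ with $\pi^1$ $12$-indecomposable, or $21[\pi^1,\pi^2]$ with $\pi^1$ $21$-indecomposable,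 or $\sigma[\pi^1,\ldots,\pi^k]$ with $\sigma$ simple of size $k$. Decomposing the $\pi^i$ recursively down to permutations of size $1$ gives the decomposition tree, whose internal nodes are labeled by $12$, $21$ or simple permutations. The substitution closure $\hat{\mathcal{C}}$ of $\mathcal{C}$ is the set of permutations whose decomposition trees have internal nodes labeled by $12$, $21$ or simple permutations of $\mathcal{C}$. $\hat{\mathcal{C}}^{+}$ (resp. $\hat{\mathcal{C}}^{-}$) is the set of $12$-indecomposable (resp. $21$-indecomposable) permutations of $\hat{\mathcal{C}}$; $\varepsilon$ is blank, $+$ or $-$, and $\hat{\mathcal{C}}^{\varepsilon}$ with $\varepsilon$ blank is $\hat{\mathcal{C}}$. The restriction $\hat{\mathcal{C}}^{\varepsilon}\langle E\rangle(A)$ is the set of permutations of $\hat{\mathcal{C}}^{\varepsilon}$ that avoid every pattern of $E$ and contain every pattern of $A$. One has $\mathcal{C}=\hat{\mathcal{C}}\langle B^\star\rangle(\emptyset)$, where $B^\star$ is the set of non-simple elements of $B$. The generating function of $\mathcal{C}$ is $C(z)=\sum_{\sigma\in\mathcal{C}}z^{|\sigma|}$. A system is positive when it contains no negative terms. A Boltzmann sampler with parameter $x$ draws $\sigma\in\mathcal{C}$ with probability proportional to $x^{|\sigma|}$, so it is uniform among permutations of $\mathcal{C}$ of the same size. *)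

(* Defs.v *)
From HB Require Import structures.
From mathcomp Require Import all_boot all_order all_algebra.
From mathcomp Require Import all_classical all_reals all_analysis.

Set Implicit Arguments.
Unset Strict Implicit.
Unset Printing Implicit Defensive.

Import Order.TTheory GRing.Theory Num.Theory.
Import numFieldNormedType.Exports.

Local Open Scope classical_set_scope.
Local Open Scope ring_scope.

(* Permutations are nonempty one-line words s_1 ... s_n over {1, ..., n}.
   Values are 1-based, positions (arguments of nth) are 0-based. *)
Definition is_perm_word (s : seq nat) : bool :=
  (s != [::]) && perm_eq s (iota 1 (size s)).

Record permutation := Permutation {
  word :> seq nat;
  _ : is_perm_word word }.

HB.instance Definition _ := [isSub for word].
HB.instance Definition _ := [Countable of permutation by <:].

Definition p1 : permutation := @Permutation [:: 1]%N isT.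
Definition p12 : permutation := @Permutation [:: 1; 2]%N isT.
Definition p21 : permutation := @Permutation [:: 2; 1]%N isT.

Definition order_iso (s t : seq nat) : Prop :=
  size s = size t /\
  forall i j, (i < size s)%N -> (j < size s)%N ->
    (nth 0 s i < nth 0 s j)%N = (nth 0 t i < nth 0 t j)%N.

Definition pattern_of (p s : permutation) : Prop :=
  exists2 t : seq nat, subseq t s & order_iso t p.

Definition Av (B : seq permutation) : set permutation :=
  [set s | forall b, b \in B -> ~ pattern_of b s].

Definition antichain (B : seq permutation) : Prop :=
  forall b c, b \in B -> c \in B -> pattern_of b c -> b = c.

Definition consecutive (s : seq nat) : Prop :=
  exists m, perm_eq s (iota m (size s)).

(* A nonempty set of consecutive positions {i, ..., i + l - 1} is an interval
   of s when the corresponding values are consecutive integers. *)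
Definition is_interval (s : permutation) (i l : nat) : Prop :=
  [/\ (0 < l)%N, (i + l <= size s)%N & consecutive (take l (drop i s))].

Definition simple_perm (s : permutation) : Prop :=
  (4 <= size s)%N /\
  forall i l, is_interval s i l -> l = 1%N \/ l = size s.

(* is_subst r ps s : s = r[ps_1, ..., ps_k] with k the size of r, the S^i being
   the blocks of s. *)
Definition is_subst (r : permutation) (ps : seq permutation) (s : permutation)
    : Prop :=
  exists2 Ss : seq (seq nat), word s = flatten Ss &
  [/\ size ps = size r, size Ss = size r,
      forall i, (i < size r)%N ->
        consecutive (nth [::] Ss i) /\
        order_iso (nth [::] Ss i) (nth p1 ps i)
    & forall i j, (i < size r)%N -> (j < size r)%N ->
        allrel ltn (nth [::] Ss i) (nth [::] Ss j)
          = (nth 0 r i < nth 0 r j)%N].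

Definition indecomposable (r s : permutation) : Prop :=
  ~ exists q1 q2, is_subst r [:: q1; q2] s.

(* A derivation of [subst_closure C s] is a decomposition tree of s all of
   whose internal nodes are labeled by 12, 21 or simple permutations of C. *)
Inductive subst_closure (C : set permutation) : permutation -> Prop :=
| sc_leaf (s : permutation) : size s = 1%N -> subst_closure C s
| sc_plus q1 q2 s :
    is_subst p12 [:: q1; q2] s -> indecomposable p12 q1 ->
    subst_closure C q1 -> subst_closure C q2 -> subst_closure C s
| sc_minus q1 q2 s :
    is_subst p21 [:: q1; q2] s -> indecomposable p21 q1 ->
    subst_closure C q1 -> subst_closure C q2 -> subst_closure C s
| sc_simple r ps s :
    simple_perm r -> C r -> is_subst r ps s ->
    (forall q, q \in ps -> subst_closure C q) -> subst_closure C s.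

Inductive epsilon := EpsBlank | EpsPlus | EpsMinus.

Definition closure_eps (C : set permutation) (e : epsilon) : set permutation :=
  match e with
  | EpsBlank => [set s | subst_closure C s]
  | EpsPlus => [set s | subst_closure C s /\ indecomposable p12 s]
  | EpsMinus => [set s | subst_closure C s /\ indecomposable p21 s]
  end.

Record restriction := Restriction {
  r_eps : epsilon;
  r_avoid : seq permutation;
  r_contain : seq permutation }.

Definition restr_set (C : set permutation) (r : restriction) : set permutation :=
  [set s | [/\ closure_eps C (r_eps r) s,
               forall p, p \in r_avoid r -> ~ pattern_of p s
             & forall p, p \in r_contain r -> pattern_of p s]].

(* [Inflate r [:: i_1; ...; i_k]] is the product term r[X_(i_1), ..., X_(i_k)],
   X_i being the set described by the i-th equation of the system.  An equation
   states that its left-hand side is the disjoint union of its terms. *)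
Inductive term :=
| Atom
| Inflate (root : permutation) (args : seq nat).

Record equation := Equation { lhs : restriction; rhs : seq term }.

Definition specification := seq equation.

Definition eq_nth (sp : specification) (i : nat) : equation :=
  nth (Equation (Restriction EpsBlank [::] [::]) [::]) sp i.

Definition spec_set (C : set permutation) (sp : specification) (i : nat)
    : set permutation :=
  restr_set C (lhs (eq_nth sp i)).

(* The permutation s arises from the term t and the tuple of components ps. *)
Definition produces (X : nat -> set permutation) (t : term)
    (ps : seq permutation) (s : permutation) : Prop :=
  match t with
  | Atom => ps = [::] /\ s = p1
  | Inflate r args =>
      [/\ size ps = size args,
          forall k, (k < size args)%N -> X (nth 0%N args k) (nth p1 ps k)
        & is_subst r ps s]
  end.

Definition wf_term (S : seq permutation) (m : nat) (t : term) : Prop :=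
  match t with
  | Atom => True
  | Inflate r args =>
      [/\ [\/ r = p12, r = p21 | r \in S],
          size args = size r & forall a, a \in args -> (a < m)%N]
  end.

(* Every term other than Atom has at least two factors, none of which contains
   a permutation of size 0: the system therefore determines its sets by
   induction on size.  Unambiguity covers both the disjointness of the unions
   and the uniqueness of the components in each product term. *)
Definition comb_specification (C : set permutation) (B S : seq permutation)
    (sp : specification) : Prop :=
  let X := spec_set C sp in
  [/\ (0 < size sp)%N /\ X 0%N = C,
      forall i j, (i < size sp)%N -> (j < size (rhs (eq_nth sp i)))%N ->
        wf_term S (size sp) (nth Atom (rhs (eq_nth sp i)) j),
      forall i s, (i < size sp)%N ->
        X i s <-> exists j ps, (j < size (rhs (eq_nth sp i)))%N /\
                    produces X (nth Atom (rhs (eq_nth sp i)) j) ps s,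
      forall i s j j' ps ps', (i < size sp)%N ->
        (j < size (rhs (eq_nth sp i)))%N ->
        (j' < size (rhs (eq_nth sp i)))%N ->
        produces X (nth Atom (rhs (eq_nth sp i)) j) ps s ->
        produces X (nth Atom (rhs (eq_nth sp i)) j') ps' s ->
        j = j' /\ ps = ps'
    & forall i p, (i < size sp)%N ->
        p \in r_avoid (lhs (eq_nth sp i)) ++ r_contain (lhs (eq_nth sp i)) ->
        exists2 b, b \in B & pattern_of p b].

Definition perms_of_size (n : nat) : seq permutation :=
  pmap insub (permutations (iota 1 n)).

(* Formal power series in z with integer coefficients. *)
Definition fps := nat -> int.

Definition fps_one : fps := fun n => (n == 0%N)%:R.
Definition fps_mul (f g : fps) : fps :=
  fun n => \sum_(k < n.+1) f k * g (n - k)%N.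

Definition gen_fun (X : set permutation) : fps :=
  fun n => (count (fun s => `[< X s >]) (perms_of_size n))%:Z.

(* coef * z ^ zdeg * \prod_(i <- unknowns) F_i *)
Record monomial := Monomial { coef : int; zdeg : nat; unknowns : seq nat }.

(* The i-th entry is the polynomial P_i, as a sum of monomials, in the
   algebraic equation F_i = P_i (z, F_0, F_1, ...). *)
Definition algebraic_system := seq (seq monomial).

Definition monomial_eval (F : nat -> fps) (m : monomial) : fps :=
  fps_mul (fun n => coef m *+ (n == zdeg m))
          (foldr (fun i f => fps_mul (F i) f) fps_one (unknowns m)).

Definition satisfies (F : nat -> fps) (sys : algebraic_system) : Prop :=
  forall i, (i < size sys)%N ->
    F i = fun n => \sum_(m <- nth [::] sys i) monomial_eval F m n.

Definition positive_system (sys : algebraic_system) : Prop :=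
  forall i j, (i < size sys)%N -> (j < size (nth [::] sys i))%N ->
    0 <= coef (nth (Monomial 0 0 [::]) (nth [::] sys i) j).

Definition gf_monomial (t : term) : monomial :=
  match t with
  | Atom => Monomial 1 1 [::]
  | Inflate _ args => Monomial 1 0 args
  end.

Definition gf_system (sp : specification) : algebraic_system :=
  [seq [seq gf_monomial t | t <- rhs e] | e <- sp].

Definition gf_value (R : realType) (X : set permutation) (x : R) : \bar R :=
  \esum_(s in X) (x ^+ size s)%:E.

Definition term_value (R : realType) (X : nat -> set permutation) (x : R)
    (t : term) : R :=
  match t with
  | Atom => x
  | Inflate _ args => \prod_(a <- args) fine (gf_value (X a) x)
  end.

(* The random sampler attached to a specification: to sample from X_i, choose a
   term t of the i-th equation with probability t(x) / X_i(x); return 1 if t is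
   the atom; if t = r[X_(i_1), ..., X_(i_k)], sample independently ps_1, ...,
   ps_k from X_(i_1), ..., X_(i_k) and return r[ps_1, ..., ps_k].
   [sampler X sp x n i s] is the probability that the call for X_i terminates
   at recursion depth at most n and returns s; the probability that it returns s
   is the limit for n --> oo.  Only finitely many ps satisfy [is_subst r ps s],
   so the finitely supported sum is a genuine one. *)
Fixpoint sampler (R : realType) (X : nat -> set permutation)
    (sp : specification) (x : R) (n i : nat) (s : permutation) : R :=
  match n with
  | 0%N => 0
  | n'.+1 =>
      \sum_(t <- rhs (eq_nth sp i))
        term_value X x t / fine (gf_value (X i) x) *
        match t with
        | Atom => (s == p1)%:R
        | Inflate r args =>
            \sum_(ps \in [set ps | is_subst r ps s])
              \prod_(k < size args)
                sampler X sp x n' (nth 0%N args k) (nth p1 ps k)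
        end
  end.

(* The output law is that of the Boltzmann distribution of C; in particular
   permutations of C of the same size are equally likely, and the sampler
   terminates with probability 1. *)
Definition boltzmann_sampler (R : realType) (C : set permutation)
    (sp : specification) (x : R) : Prop :=
  (forall s, C s ->
     sampler (spec_set C sp) sp x n 0 s @[n --> \oo]
       --> x ^+ size s / fine (gf_value C x)) /\
  (forall s, ~ C s ->
     sampler (spec_set C sp) sp x n 0 s @[n --> \oo] --> (0 : R)).

(* Model of computation: point-free WHILE programs over binary trees (the WHILE
   language of N. Jones, "Computability and Complexity", with the store held in
   a single tree).  Nil is false, every other tree is true.  A program
   terminates on x when [run p x y] holds for some y, which is then unique. *)
Inductive tree := Nil | Cons (a b : tree).

Inductive program :=
| PId
| PNil
| PHead
| PTail
| PCons (p q : program)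
| PEq (p q : program)
| PSeq (p q : program)
| PIf (c p q : program)
| PWhile (c p : program).

Inductive run : program -> tree -> tree -> Prop :=
| run_id x : run PId x x
| run_nil x : run PNil x Nil
| run_head a b : run PHead (Cons a b) a
| run_head_nil : run PHead Nil Nil
| run_tail a b : run PTail (Cons a b) b
| run_tail_nil : run PTail Nil Nil
| run_cons p q x y z : run p x y -> run q x z -> run (PCons p q) x (Cons y z)
| run_eq_true p q x y : run p x y -> run q x y -> run (PEq p q) x (Cons Nil Nil)
| run_eq_false p q x y z : run p x y -> run q x z -> y <> z ->
    run (PEq p q) x Nil
| run_seq p q x y z : run p x y -> run q y z -> run (PSeq p q) x z
| run_if_true c p q x a b y : run c x (Cons a b) -> run p x y ->
    run (PIf c p q) x y
| run_if_false c p q x y : run c x Nil -> run q x y -> run (PIf c p q) x y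
| run_while_stop c p x : run c x Nil -> run (PWhile c p) x x
| run_while_step c p x a b y z : run c x (Cons a b) -> run p x y ->
    run (PWhile c p) y z -> run (PWhile c p) x z.

Fixpoint enc_nat (n : nat) : tree :=
  if n is n'.+1 then Cons Nil (enc_nat n') else Nil.

Definition enc_seq (T : Type) (enc : T -> tree) (s : seq T) : tree :=
  foldr (fun a t => Cons (enc a) t) Nil s.

Definition enc_perm (s : permutation) : tree := enc_seq enc_nat (word s).

Definition enc_eps (e : epsilon) : tree :=
  match e with
  | EpsBlank => enc_nat 0
  | EpsPlus => enc_nat 1
  | EpsMinus => enc_nat 2
  end.

Definition enc_restriction (r : restriction) : tree :=
  Cons (enc_eps (r_eps r))
    (Cons (enc_seq enc_perm (r_avoid r)) (enc_seq enc_perm (r_contain r))).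

Definition enc_term (t : term) : tree :=
  match t with
  | Atom => Nil
  | Inflate r args => Cons (enc_perm r) (enc_seq enc_nat args)
  end.

Definition enc_equation (e : equation) : tree :=
  Cons (enc_restriction (lhs e)) (enc_seq enc_term (rhs e)).

Definition enc_input (B S : seq permutation) : tree :=
  Cons (enc_seq enc_perm B) (enc_seq enc_perm S).

Definition enc_specification (sp : specification) : tree :=
  enc_seq enc_equation sp.

(* Main.v *)
Require Import Defs.
From mathcomp Require Import all_boot all_order all_algebra.
From mathcomp Require Import all_classical all_reals all_analysis.
From mathcomp Require Import zify.

(* Let P be the finite set of all patterns of elements of B, and let the type of
   a permutation be the set of the elements of P that it contains.  An
   occurrence of p in r[s_1, ..., s_k] cuts p into k consecutive parts, each
   empty or a pattern of the corresponding s_i, hence again in P; so the type of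
   r[s_1, ..., s_k] is a function of r and of the types of the s_i.  The sets
   "12-indecomposability constraint e and type exactly T", for T without element
   of B, are restrictions that avoid P \ T and contain T.  Sorting the
   decompositions of a permutation by root and by types of the components
   describes each of them as a disjoint union of products, and C is the disjoint
   union of those with e blank.  Unambiguity is the uniqueness of the
   decomposition.

   Since every term is a product of at least two nonempty factors, the sampler
   returns s with its exact Boltzmann probability as soon as the recursion depth
   reaches |s|; only subsets of C are sampled, so all the values are finite.

   The map (B, S) |-> specification is a composition of left folds over lists,
   and each left fold is one WHILE loop. *)

(** Exact types make disjointness easy: terms with the same root whose components have different
    types share no tuple of components, so ambiguity could only come from a second decomposition of
    the same permutation. The price is a number of equations that may be exponential in the size of
    P.

    Uniqueness is proved on raw words, without standardizing the blocks, so that two decompositions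
    of one word can be compared block by block. Where two decompositions with simple roots first
    differ, the shorter block is a proper prefix of the longer one. One value chosen in each block
    then turns the overlap into a nontrivial interval of a simple root. Existence goes the other
    way: blocks of size 1 are merged along intervals until the root is simple or has size 2.

    Computability is stated for functions of an environment E, because the body of an inner fold
    refers to the variables of the outer folds; entering a fold extends the environment by
    pairing. *)

Set Implicit Arguments.
Unset Strict Implicit.
Unset Printing Implicit Defensive.

Import Order.TTheory GRing.Theory Num.Theory.
Import numFieldNormedType.Exports.

Local Open Scope nat_scope.

(* [lia] does not recognize [Equality.sort] of a concrete instance as the
   underlying type. *)
Ltac norm_sort :=
  repeat match goal with
  | |- context [Equality.sort ?T] =>
      let T' := eval hnf in (Equality.sort T) in
      progress change (Equality.sort T) with T'
  | H : context [Equality.sort ?T] |- _ =>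
      let T' := eval hnf in (Equality.sort T) in
      progress change (Equality.sort T) with T' in H
  end.
Ltac slia := try lia; norm_sort; lia.

(** * Standardization and patterns *)

(** Pairs of corresponding entries, unlike indices, behave well under concatenation of words. *)
Lemma order_isoP (s t : seq nat) :
  order_iso s t <->
  size s = size t /\ {in zip s t &, forall u v, (u.1 < v.1) = (u.2 < v.2)}.
Proof.
split=> -[sz H]; split=> //.
  move=> u v /(nthP (0, 0))[i]; rewrite size1_zip ?sz // => hi <-.
  move=> /(nthP (0, 0))[j]; rewrite size1_zip ?sz // => hj <-.
  by rewrite !nth_zip //=; apply: H; rewrite ?sz.
move=> i j hi hj.
have M k : k < size s -> (nth 0 s k, nth 0 t k) \in zip s t.
  by move=> hk; rewrite -nth_zip // mem_nth // size1_zip // sz.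
exact: (H _ _ (M i hi) (M j hj)).
Qed.

Lemma order_iso_sym s t : order_iso s t -> order_iso t s.
Proof. by case=> sz H; split=> // i j hi hj; rewrite H ?sz. Qed.

Lemma order_iso_trans t s u : order_iso s t -> order_iso t u -> order_iso s u.
Proof.
move=> [sz H] [sz' H']; split; first by rewrite sz.
by move=> i j hi hj; rewrite H // H' // -sz.
Qed.

Lemma order_iso_map f s :
  {in s &, {mono f : x y / x < y}} -> order_iso s (map f s).
Proof.
move=> mf; split; first by rewrite size_map.
by move=> i j hi hj; rewrite !(nth_map 0) // mf ?mem_nth.
Qed.

Lemma order_iso_uniq s t : order_iso s t -> uniq s -> uniq t.
Proof.
move=> [sz H] /(uniqP 0) us; apply/(uniqP 0) => i j.
rewrite !inE -!sz => hi hj e; apply: us; rewrite ?inE //.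
have := H _ _ hi hj; have := H _ _ hj hi; rewrite e ltnn.
by case: (ltngtP (nth 0 s i) (nth 0 s j)).
Qed.

Definition rank (w : seq nat) (x : nat) : nat := count (fun y => y <= x) w.
Definition stdw (w : seq nat) : seq nat := map (rank w) w.
(** The value [p1] is taken on empty words and on words with repeated entries, where [stdw] is not a
    permutation word. *)
Definition std (w : seq nat) : permutation := insubd p1 (stdw w).

Lemma rank_mono w : {in w &, {mono rank w : x y / x < y}}.
Proof.
have le x y : x <= y -> rank w x <= rank w y.
  by move=> xy; apply: sub_count => z /= /leq_trans; apply.
have lt x y : y \in w -> x < y -> rank w x < rank w y.
  move=> yw xy; rewrite /rank.
  have -> : count (fun z => z <= y) w =
     count (fun z => z <= x) w + count (fun z => (x < z) && (z <= y)) w.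
    rewrite -count_predUI -[LHS]addn0; congr (_ + _).
      by apply: eq_count => z /=; lia.
    by symmetry; apply/eqP; rewrite -leqn0 leqNgt -has_count; apply/hasPn => z _ /=; lia.
  rewrite -[X in X < _]addn0 ltn_add2l -has_count; apply/hasP; exists y => //=.
  by rewrite xy /=.
move=> x y xw yw /=; case: (ltnP x y) => [/lt->//|/le]; lia.
Qed.

Lemma order_iso_stdw w : order_iso w (stdw w).
Proof. exact/order_iso_map/rank_mono. Qed.

Lemma mem_perm_word s x : is_perm_word s -> (x \in s) = (0 < x <= size s).
Proof. by case/andP=> _ /perm_mem ->; rewrite mem_iota; lia. Qed.

Lemma uniq_perm_word s : is_perm_word s -> uniq s.
Proof. by case/andP=> _ /perm_uniq ->; apply: iota_uniq. Qed.

Lemma stdw_perm_word w : uniq w -> w != [::] -> is_perm_word (stdw w).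
Proof.
move=> uw w0; have us := order_iso_uniq (order_iso_stdw w) uw.
have sub : {subset stdw w <= iota 1 (size (stdw w))}.
  move=> x /mapP[y yw ->]; rewrite mem_iota size_map add1n ltnS count_size andbT.
  by rewrite -has_count; apply/hasP; exists y => /=.
apply/andP; split; first by rewrite -size_eq0 size_map size_eq0.
have [|_ e] := uniq_min_size us sub; first by rewrite size_iota.
by apply: uniq_perm => //; apply: iota_uniq.
Qed.

(** A rank depends only on comparisons; both ranks become counts over the same zipped list. *)
Lemma eq_stdw s t : order_iso s t -> stdw s = stdw t.
Proof.
case/order_isoP=> sz H; apply: (@eq_from_nth _ 0); rewrite !size_map // => i hi.
rewrite !(nth_map 0) -?sz // /rank.
have -> x : count (leq^~ x) s = count (fun u => u.1 <= x) (zip s t).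
  by rewrite -{1}(unzip1_zip (s := s) (t := t)) ?sz // count_map.
have -> x : count (leq^~ x) t = count (fun u => u.2 <= x) (zip s t).
  by rewrite -{1}(unzip2_zip (s := s) (t := t)) ?sz // count_map.
apply: eq_in_count => u hu /=; rewrite leqNgt [RHS]leqNgt; congr (~~ _).
apply: (H (nth 0 s i, nth 0 t i) u) => //.
by rewrite -nth_zip // mem_nth // size1_zip // sz.
Qed.

Lemma stdw_id s : is_perm_word s -> stdw s = s.
Proof.
move=> ps; rewrite -[RHS]map_id; apply/eq_in_map => x.
rewrite mem_perm_word // => /andP[x0 xs]; rewrite /rank.
have /andP[_ /permP ->] := ps.
have -> : size s = x + (size s - x) by lia.
rewrite iotaD count_cat -[RHS]addn0 -[X in _ = X + _](size_iota 1 x); congr (_ + _).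
  by apply/eqP; rewrite -all_count; apply/allP => y; rewrite mem_iota; lia.
by apply/eqP; rewrite -leqn0 leqNgt -has_count; apply/hasPn => y; rewrite mem_iota; lia.
Qed.

Lemma word_perm (p : permutation) : is_perm_word p.
Proof. exact: (valP p). Qed.
#[local] Hint Resolve word_perm : core.

Lemma word_uniq (p : permutation) : uniq p.
Proof. exact/uniq_perm_word/word_perm. Qed.
#[local] Hint Resolve word_uniq : core.

Lemma word_neq0 (p : permutation) : word p != [::].
Proof. by have /andP[] := word_perm p. Qed.

Lemma size_word_gt0 (p : permutation) : 0 < size p.
Proof. by case: p => -[]. Qed.

Lemma word_inj : injective word.
Proof. exact: val_inj. Qed.

Lemma order_iso_perm (p q : permutation) : order_iso p q -> p = q.
Proof. by move=> /eq_stdw; rewrite !stdw_id // => /word_inj. Qed.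

Lemma word_std w : uniq w -> w != [::] -> word (std w) = stdw w.
Proof. by move=> uw w0; rewrite /std -[word _]/(val _) val_insubd stdw_perm_word. Qed.

Lemma stdK (p : permutation) : std p = p.
Proof. by apply: word_inj; rewrite word_std ?word_neq0 // stdw_id. Qed.

Lemma eq_std s t : order_iso s t -> std s = std t.
Proof. by move=> /eq_stdw; rewrite /std => ->. Qed.

Lemma order_iso_std w : uniq w -> w != [::] -> order_iso w (std w).
Proof. by move=> uw w0; rewrite word_std //; apply: order_iso_stdw. Qed.

Lemma size_std w : uniq w -> w != [::] -> size (std w) = size w.
Proof. by move=> uw w0; case: (order_iso_std uw w0). Qed.

Lemma std_eqP s t : uniq s -> s != [::] -> uniq t -> t != [::] ->
  std s = std t <-> order_iso s t.
Proof.
move=> us s0 ut t0; split; last exact: eq_std.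
move=> e; apply: order_iso_trans (order_iso_std us s0) _.
by rewrite e; apply/order_iso_sym/order_iso_std.
Qed.

Lemma perm_size1 (p : permutation) : size p = 1 -> p = p1.
Proof.
move=> sz; apply: order_iso_perm; split=> // i j; rewrite sz.
by case: i j => [|//] [|//]; rewrite !ltnn.
Qed.

(** The order of the entries is kept, so each subset of a duplicate-free list is represented exactly
    once. The recursion is a right fold, which is what makes it computable. *)
Fixpoint subs (T : Type) (w : seq T) : seq (seq T) :=
  if w is x :: w' then map (cons x) (subs w') ++ subs w' else [:: [::]].

Lemma mem_subs (T : eqType) (w t : seq T) : (t \in subs w) = subseq t w.
Proof.
elim: w t => [|x w IH] [|y t] //=.
  by rewrite mem_cat IH sub0seq orbT.
rewrite mem_cat IH; case: eqP => [->|n].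
  rewrite mem_map ?IH; last by move=> ? ? [].
  apply/orP/idP => [[//|h]|h]; last by left.
  exact: subseq_trans (subseq_cons _ _) h.
by case: mapP => // -[z _ [e]]; case: n.
Qed.

Lemma uniq_subs (T : eqType) (w : seq T) : uniq w -> uniq (subs w).
Proof.
elim: w => //= x w IH /andP[xw uw]; rewrite cat_uniq map_inj_uniq ?IH //; last by move=> ? ? [].
rewrite /= andbT; apply/hasPn => t; rewrite mem_subs => st; apply/mapP => -[z _ e].
by move: xw; rewrite (mem_subseq st) // e mem_head.
Qed.

Definition pats (s : permutation) : seq permutation :=
  [seq std w | w <- subs (word s) & w != [::]].

Lemma patternP p s :
  pattern_of p s <-> exists t, [/\ subseq t (word s), t != [::] & std t = p].
Proof.
split=> [[t st o]|[t [st t0 <-]]]; exists t => //.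
  split=> //; last by rewrite (eq_std o) stdK.
  by rewrite -size_eq0 (proj1 o) size_eq0 word_neq0.
by apply: order_iso_std => //; apply: subseq_uniq st _.
Qed.

Lemma mem_pats p s : reflect (pattern_of p s) (p \in pats s).
Proof.
apply: (iffP mapP) => [[t]|/patternP[t [st t0 <-]]].
  by rewrite mem_filter mem_subs => /andP[t0 st ->]; apply/patternP; exists t.
by exists t; rewrite // mem_filter t0 mem_subs.
Qed.

Lemma pattern_subseq s t : uniq t -> s != [::] -> subseq s t ->
  pattern_of (std s) (std t).
Proof.
move=> ut s0 st; have t0 : t != [::] by move: st; case: t {ut} => //; case: s s0.
apply/patternP; exists (map (rank t) s); split.
- by rewrite word_std //; apply: map_subseq.
- by rewrite -size_eq0 size_map size_eq0.
apply/esym/eq_std/order_iso_map => x y xs ys.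
by apply: rank_mono; apply: (mem_subseq st).
Qed.

(** An occurrence in [std u] is selected by a mask; the same mask applied to [u] selects an
    occurrence in [s]. *)
Lemma pattern_trans q p s : pattern_of p q -> pattern_of q s -> pattern_of p s.
Proof.
move=> /patternP[t [st t0 <-]] /patternP[u [su u0 e]]; subst q.
have uu := subseq_uniq su (word_uniq s).
rewrite word_std // in st; case/subseqP: st => m sm e.
have := map_mask (rank u) m u; rewrite -/(stdw u) -e => {}e.
have d0 : mask m u != [::] by move: t0; rewrite -e; case: (mask m u).
apply/patternP; exists (mask m u); split=> //.
  exact: subseq_trans (mask_subseq _ _) su.
rewrite -e; apply/eq_std/order_iso_map => x y xs ys.
by apply: rank_mono; apply: (mem_mask (m := m)).
Qed.

Lemma pattern_refl p : pattern_of p p.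
Proof. by exists p. Qed.

(** * Inflations *)

(** Only one direction of the equivalence in [is_subst], so that empty blocks are allowed: a pattern
    may miss some blocks of an inflation. For nonempty distinct blocks the other direction follows
    from [compat_lt]. *)
Definition compat (r : seq nat) (Ss : seq (seq nat)) : bool :=
  all (fun u => all (fun v => (u.1 < v.1) ==> allrel ltn u.2 v.2) (zip r Ss))
    (zip r Ss).

Lemma compatP (r : seq nat) (Ss : seq (seq nat)) :
  reflect {in zip r Ss &, forall u v, u.1 < v.1 ->
             forall x y, x \in u.2 -> y \in v.2 -> x < y}
          (compat r Ss).
Proof.
apply: (iffP allP) => [H u v hu hv uv x y xu yv|H u hu].
  by have /allP/(_ _ hv)/implyP/(_ uv)/allrelP := H _ hu; apply.
by apply/allP => v hv; apply/implyP => uv; apply/allrelP => x y; apply: H.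
Qed.

Lemma compat_nthP (r : seq nat) (Ss : seq (seq nat)) : size Ss = size r ->
  reflect (forall i j x y, nth 0 r i < nth 0 r j -> x \in nth [::] Ss i ->
             y \in nth [::] Ss j -> x < y)
          (compat r Ss).
Proof.
move=> sz; have lt i x : x \in nth [::] Ss i -> i < size r.
  by rewrite -sz; case: ltnP => // h; rewrite nth_default.
have M i : i < size r -> (nth 0 r i, nth [::] Ss i) \in zip r Ss.
  by move=> h; rewrite -nth_zip // mem_nth // size1_zip // sz.
apply: (iffP (compatP _ _)) => [H i j x y ij xi yj|H u v].
  exact: (H _ _ (M _ (lt _ _ xi)) (M _ (lt _ _ yj))).
move=> /(nthP (0, [::]))[i]; rewrite size1_zip ?sz // => hi <-.
move=> /(nthP (0, [::]))[j]; rewrite size1_zip ?sz // => hj <-.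
by rewrite !nth_zip //= => ij x y; apply: H.
Qed.

Lemma flatten_nthP (Ss : seq (seq nat)) x :
  reflect (exists i, x \in nth [::] Ss i) (x \in flatten Ss).
Proof.
apply: (iffP flattenP) => [[S /(nthP [::])[i hi <-] xS]|[i xi]]; first by exists i.
exists (nth [::] Ss i) => //; apply: mem_nth.
by case: ltnP xi => // h; rewrite nth_default.
Qed.

Lemma nth_neq_nil (Ss : seq (seq nat)) i : [::] \notin Ss -> i < size Ss ->
  nth [::] Ss i != [::].
Proof. by move=> n0 hi; apply: contraNneq n0 => <-; apply: mem_nth. Qed.

Lemma head_nth (Ss : seq (seq nat)) i : [::] \notin Ss -> i < size Ss ->
  head 0 (nth [::] Ss i) \in nth [::] Ss i.
Proof.
by move=> n0 hi; have := nth_neq_nil n0 hi; case: nth => // x S _; apply: mem_head.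
Qed.

Lemma mem_nth_size (Ss : seq (seq nat)) i x : x \in nth [::] Ss i -> i < size Ss.
Proof. by case: ltnP => // h; rewrite nth_default. Qed.

Lemma compat_lt (r : permutation) Ss i j x y :
  size Ss = size r -> compat r Ss ->
  x \in nth [::] Ss i -> y \in nth [::] Ss j -> i != j ->
  (x < y) = (nth 0 r i < nth 0 r j).
Proof.
move=> sz /(compat_nthP sz) H xi yj ij; have hi := mem_nth_size xi.
have hj := mem_nth_size yj; case: (ltngtP (nth 0 r i) (nth 0 r j)) => h.
- exact: H h xi yj.
- by have := H _ _ _ _ h yj xi; case: (ltngtP x y).
- by move: ij; rewrite -(nth_uniq 0 (s := r)) -?sz // h eqxx.
Qed.

Lemma convex_consecutive S : uniq S -> S != [::] ->
  (forall x y z, x \in S -> z \in S -> x < y < z -> y \in S) -> consecutive S.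
Proof.
move=> uS S0 conv.
have ex : exists x, x \in S by case: S S0 {uS conv} => // x S _; exists x; rewrite mem_head.
(* The sum of the entries serves as a crude bound for the existence of a maximum. *)
have ub x : x \in S -> x <= sumn S.
  by move=> /perm_to_rem/perm_sumn -> /=; apply: leq_addr.
have [m mS mmin] := ex_minnP ex; have [M MS Mmax] := ex_maxnP ex ub.
have e : S =i iota m (M - m).+1.
  move=> y; rewrite mem_iota; apply/idP/idP => [yS|h].
    by have := mmin _ yS; have := Mmax _ yS; lia.
  case: (eqVneq y m) => [-> //|ym]; case: (eqVneq y M) => [-> //|yM].
  by apply: (conv m y M) => //; lia.
have pe := uniq_perm uS (iota_uniq _ _) e.
by exists m; rewrite (perm_size pe) size_iota.
Qed.

Lemma flatten_nth_uniq (Ss : seq (seq nat)) i : uniq (flatten Ss) -> uniq (nth [::] Ss i).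
Proof.
case: (ltnP i (size Ss)) => [hi|h _]; last by rewrite nth_default.
move: hi; elim: Ss i => [|S Ss IH] [|i] //= hi; rewrite cat_uniq => /and3P[u _ v] //.
exact: IH.
Qed.

(** What remains of [is_subst] when blocks are kept as raw values: the components are recovered by
    standardizing them. *)
Definition blocks (r : permutation) (Ss : seq (seq nat)) (s : seq nat) : Prop :=
  [/\ s = flatten Ss, size Ss = size r, [::] \notin Ss & compat r Ss].

(** Consecutiveness of the blocks is automatic. A value between two values of block [i] occurs
    somewhere in [s]; if it were in another block [j], comparing it with both would put [j] both
    above and below [i]. *)
Lemma is_substE r ps s :
  is_subst r ps s <-> exists2 Ss, blocks r Ss s & ps = map std Ss.
Proof.
split.
  move=> [Ss e [szp sz H1 H2]]; exists Ss.
    split=> //.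
      apply/negP => /(nthP [::])[i hi e0]; rewrite sz in hi.
      have [_ [se _]] := H1 i hi; have := size_word_gt0 (nth p1 ps i).
      by rewrite -se e0.
    apply/compat_nthP => // i j x y ij xi yj.
    have := H2 i j; rewrite -sz (mem_nth_size xi) (mem_nth_size yj) ij.
    by move=> /(_ isT isT)/allrelP; apply.
  apply: (@eq_from_nth _ p1); first by rewrite size_map szp sz.
  move=> i; rewrite szp => hi; rewrite (nth_map [::]) ?sz //.
  by have [_ o] := H1 i hi; rewrite (eq_std o) stdK.
move=> [Ss [e sz n0 c] ->]; have us : uniq (flatten Ss) by rewrite -e.
have lt i j x y (xi : x \in nth [::] Ss i) (yj : y \in nth [::] Ss j) :=
  compat_lt sz c xi yj.
exists Ss => //; split; rewrite ?size_map //.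
  move=> i; rewrite -sz => hi; split; last first.
    rewrite (nth_map [::]) //; apply: order_iso_std; last exact: nth_neq_nil.
    exact: flatten_nth_uniq.
  apply: convex_consecutive => [||x y z xi zi xyz].
  - exact: flatten_nth_uniq.
  - exact: nth_neq_nil.
  have : y \in word s.
    rewrite mem_perm_word //.
    have : x \in word s by rewrite e; apply/flatten_nthP; exists i.
    have : z \in word s by rewrite e; apply/flatten_nthP; exists i.
    by rewrite !mem_perm_word //; lia.
  rewrite e => /flatten_nthP[j yj]; case: (eqVneq i j) => [-> //|ij].
  by have := lt _ _ _ _ xi yj ij; have := lt _ _ _ _ zi yj ij; lia.
move=> i j; rewrite -sz => hi hj; have [->|ij] := eqVneq i j.
  rewrite ltnn; apply/negP => /allrelP /(_ _ _ (head_nth n0 hj) (head_nth n0 hj)).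
  by rewrite /= ltnn.
apply/allrelP/idP => [/(_ _ _ (head_nth n0 hi) (head_nth n0 hj))|h x y xi yj].
  by rewrite /= (lt _ _ _ _ (head_nth n0 hi) (head_nth n0 hj) ij).
by rewrite /= (lt _ _ _ _ xi yj ij).
Qed.

Lemma mem_zip_flatten (Ss Ts : seq (seq nat)) u : map size Ss = map size Ts ->
  u \in zip (flatten Ss) (flatten Ts) ->
  exists i, u \in zip (nth [::] Ss i) (nth [::] Ts i).
Proof.
elim: Ss Ts => [|S Ss IH] [|T Ts] //= [sz /IH{}IH].
rewrite zip_cat // mem_cat => /orP[h|/IH[i h]]; first by exists 0.
by exists i.+1.
Qed.

Lemma mem_zip_mem (s t : seq nat) u : size s = size t -> u \in zip s t ->
  u.1 \in s /\ u.2 \in t.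
Proof.
move=> sz /(nthP (0, 0))[i]; rewrite size1_zip ?sz // => hi <-.
by rewrite nth_zip //= !mem_nth ?sz.
Qed.

Lemma order_iso_flatten (r : permutation) Ss Ts :
  size Ss = size r -> size Ts = size r -> compat r Ss -> compat r Ts ->
  (forall i, order_iso (nth [::] Ss i) (nth [::] Ts i)) ->
  order_iso (flatten Ss) (flatten Ts).
Proof.
move=> sS sT cS cT H.
have sz i : size (nth [::] Ss i) = size (nth [::] Ts i) by case: (H i).
have esz : map size Ss = map size Ts.
  apply: (@eq_from_nth _ 0); rewrite !size_map ?sT // => i hi.
  by rewrite !(nth_map [::]) ?sT // -?sS.
apply/order_isoP; split; first by rewrite !size_flatten /shape esz.
move=> u v /(mem_zip_flatten esz)[i ui] /(mem_zip_flatten esz)[j vj].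
have [ui1 ui2] := mem_zip_mem (sz i) ui; have [vj1 vj2] := mem_zip_mem (sz j) vj.
have [ij|ij] := eqVneq i j; last by rewrite (compat_lt sS cS ui1 vj1 ij) (compat_lt sT cT ui2 vj2 ij).
by subst j; have /order_isoP[_] := H i; apply.
Qed.

Lemma is_subst_inj r ps s s' : is_subst r ps s -> is_subst r ps s' -> s = s'.
Proof.
move=> /is_substE[Ss [e sz n0 c] ep] /is_substE[Ts [e' sz' n0' c'] ep'].
apply: order_iso_perm; rewrite e e'; apply: (order_iso_flatten sz sz' c c') => i.
have [hi|hi] := ltnP i (size r); last by rewrite !nth_default ?sz ?sz'.
rewrite -sz in hi; have hi' : i < size Ts by rewrite sz' -sz.
apply/std_eqP.
- by apply: flatten_nth_uniq; rewrite -e.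
- exact: nth_neq_nil.
- by apply: flatten_nth_uniq; rewrite -e'.
- exact: nth_neq_nil.
by rewrite -!(nth_map [::] p1 std) // -ep -ep'.
Qed.

Lemma size_subst r ps s : is_subst r ps s -> size s = sumn [seq size (word p) | p <- ps].
Proof.
move=> /is_substE[Ss [e sz n0 c] ->]; rewrite e size_flatten /shape -map_comp.
congr sumn; apply/eq_in_map => S SS /=; rewrite size_std //.
  by have/(nthP [::])[i _ <-] := SS; apply: flatten_nth_uniq; rewrite -e.
by apply: contraNneq n0 => <-.
Qed.

Lemma size_subst_args r ps s : is_subst r ps s -> size ps = size r.
Proof. by case=> Ss _ []. Qed.

Lemma compat_map r Ss f : {in flatten Ss &, {mono f : x y / x < y}} ->
  size Ss = size r -> compat r Ss -> compat r (map (map f) Ss).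
Proof.
move=> mf sz /(compat_nthP sz) c; apply/compat_nthP; first by rewrite size_map.
move=> i j x y ij xi yj.
have hi := mem_nth_size xi; have hj := mem_nth_size yj.
rewrite size_map in hi hj; rewrite !(nth_map [::]) // in xi yj.
case/mapP: xi yj => [x' xi ->] /mapP[y' yj ->]; rewrite mf //; first exact: c ij xi yj.
  by apply/flatten_nthP; exists i.
by apply/flatten_nthP; exists j.
Qed.

Lemma blocks_uniq_flatten (r : permutation) Ss : size Ss = size r -> compat r Ss ->
  (forall i, uniq (nth [::] Ss i)) -> uniq (flatten Ss).
Proof.
move=> sz c; have /uniq_perm_word := word_perm r; move: (word r) sz c => {}r.
elim: r Ss => [|a r IH] [|S Ss] //= [sz] /compatP c /andP[ar ur] U.
rewrite cat_uniq (U 0) (IH Ss) //= ?andbT; last first.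
- by move=> i; apply: (U i.+1).
- by apply/compatP => u v hu hv; apply: c; rewrite in_cons ?hu ?hv orbT.
apply/hasPn => x /flatten_nthP[i xi]; apply/negP => xS.
have hi := mem_nth_size xi.
have h : (nth 0 r i, nth [::] Ss i) \in zip r Ss.
  by rewrite -nth_zip // mem_nth // size1_zip // -sz.
have h1 : (nth 0 r i, nth [::] Ss i) \in (a, S) :: zip r Ss by rewrite in_cons h orbT.
have h2 : (a, S) \in (a, S) :: zip r Ss by rewrite mem_head.
case: (ltngtP a (nth 0 r i)) => e.
- by have := c _ _ h2 h1 e _ _ xS xi; rewrite ltnn.
- by have := c _ _ h1 h2 e _ _ xi xS; rewrite ltnn.
- by move: ar; rewrite e mem_nth // -sz.
Qed.

Lemma blocks_std (r : permutation) Ss : size Ss = size r -> [::] \notin Ss ->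
  compat r Ss -> (forall i, uniq (nth [::] Ss i)) ->
  is_subst r (map std Ss) (std (flatten Ss)).
Proof.
move=> sz n0 c U; have uf := blocks_uniq_flatten sz c U.
have hS i : i < size r -> nth [::] Ss i != [::] by move=> hi; apply: nth_neq_nil; rewrite ?sz.
have f0 : flatten Ss != [::].
  have := head_nth n0 (i := 0); rewrite sz size_word_gt0 => /(_ isT) h.
  have : head 0 (nth [::] Ss 0) \in flatten Ss by apply/flatten_nthP; exists 0.
  by case: flatten.
apply/is_substE; exists (map (map (rank (flatten Ss))) Ss).
  split; rewrite ?size_map //.
  - by rewrite word_std // /stdw map_flatten.
  - by apply/mapP => -[S SS]; case: S SS => // SS; rewrite SS in n0.
  - by apply: compat_map => //; apply: rank_mono.
rewrite -map_comp; apply/eq_in_map => S SS /=.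
apply/eq_std/order_iso_map => x y xS yS; apply: rank_mono; apply/flattenP; by exists S.
Qed.

(** An entry of a component is at most the size of that component, hence less than [N]. Shifting the
    blocks by multiples of [N] therefore places them in disjoint ranges ordered as [r], and [std]
    closes the gaps. *)
Definition infl (r : permutation) (ps : seq permutation) : permutation :=
  let N := (sumn [seq size (word p) | p <- ps]).+1 in
  std (flatten [seq map (addn (u.1 * N)) (word u.2) | u <- zip (word r) ps]).

Lemma inflP (r : permutation) (ps : seq permutation) : size ps = size r -> is_subst r ps (infl r ps).
Proof.
move=> sz; rewrite /infl; set N := _.+1; set Ss := [seq _ | _ <- _].
have sS : size Ss = size r by rewrite size_map size1_zip ?sz.
have nS i : i < size r -> nth [::] Ss i = map (addn (nth 0 r i * N)) (nth p1 ps i).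
  by move=> hi; rewrite (nth_map (0, p1)) ?size1_zip ?sz // nth_zip.
have -> : ps = map std Ss.
  apply: (@eq_from_nth _ p1) => [|i]; first by rewrite size_map sS.
  rewrite sz => hi.
  rewrite (nth_map [::]) ?sS // nS // -[LHS]stdK; apply/eq_std/order_iso_map => x y _ _.
  by rewrite ltn_add2l.
apply: blocks_std => //.
- apply/negP => /(nthP [::])[i]; rewrite sS => hi; rewrite nS //.
  by move=> /(congr1 size); rewrite size_map => /eqP; rewrite -leqn0 leqNgt size_word_gt0.
- apply/compat_nthP => // i j x y ij xi yj.
  have hi := mem_nth_size xi; have hj := mem_nth_size yj.
  rewrite sS in hi hj; rewrite !nS // in xi yj.
  case/mapP: xi yj => [x' xi ->] /mapP[y' yj ->].
  have : x' < N.
    move: xi; rewrite mem_perm_word // => /andP[_ xi]; rewrite ltnS; apply: leq_trans xi _.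
    have : nth p1 ps i \in ps by rewrite mem_nth ?sz.
    by move=> /perm_to_rem/(perm_map (fun p : permutation => size p))/perm_sumn -> /=; apply: leq_addr.
  by nia.
- move=> i; have [hi|hi] := ltnP i (size r); last by rewrite nth_default // sS.
  by rewrite nS // map_inj_uniq //; apply: addnI.
Qed.

Lemma is_substP r ps s : is_subst r ps s -> s = infl r ps.
Proof. by move=> h; apply: is_subst_inj h (inflP (size_subst_args h)). Qed.

Lemma subseq_catP (T : eqType) (t s1 s2 : seq T) : subseq t (s1 ++ s2) ->
  exists t1 t2, [/\ t = t1 ++ t2, subseq t1 s1 & subseq t2 s2].
Proof.
case/subseqP => m sm ->; exists (mask (take (size s1) m) s1), (mask (drop (size s1) m) s2).
rewrite -mask_cat ?cat_take_drop ?mask_subseq //.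
by rewrite size_takel // sm size_cat leq_addr.
Qed.

Lemma subseq_flattenP (Ss : seq (seq nat)) t : subseq t (flatten Ss) ->
  exists ts, [/\ size ts = size Ss, t = flatten ts &
    forall i, subseq (nth [::] ts i) (nth [::] Ss i)].
Proof.
elim: Ss t => [|S Ss IH] t.
  by rewrite subseq0 => /eqP ->; exists [::]; split=> // i; rewrite nth_nil.
rewrite [flatten _]/=; case/subseq_catP => t1 [t2 [-> st1 /IH[ts [sz -> H]]]].
by exists (t1 :: ts); split=> //= [|[|i]] //=; rewrite sz.
Qed.

Lemma flatten_subseq (ts Ss : seq (seq nat)) : size ts = size Ss ->
  (forall i, subseq (nth [::] ts i) (nth [::] Ss i)) ->
  subseq (flatten ts) (flatten Ss).
Proof.
elim: ts Ss => [|t ts IH] [|S Ss] //= [sz] H.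
by apply: cat_subseq; [apply: (H 0)|apply: IH => // i; apply: (H i.+1)].
Qed.

(* An occurrence of [p] in [r[ps]] cuts [p] into the parts [ws] falling in the
   successive blocks. *)
Definition fits_in (r : permutation) (ps : seq permutation) (p : permutation) : Prop :=
  exists ws, [/\ flatten ws = word p, size ws = size r, compat r ws &
    forall i, i < size r -> nth [::] ws i != [::] ->
      pattern_of (std (nth [::] ws i)) (nth p1 ps i)].

Lemma compat_subseq (r : seq nat) (ts Ss : seq (seq nat)) : size ts = size r ->
  size Ss = size r -> (forall i, subseq (nth [::] ts i) (nth [::] Ss i)) ->
  compat r Ss -> compat r ts.
Proof.
move=> st sS H /(compat_nthP sS) c; apply/(compat_nthP st) => i j x y ij xi yj.
by apply: c ij _ _; [apply: mem_subseq (H i) _ xi|apply: mem_subseq (H j) _ yj].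
Qed.

(** Left to right, the occurrence is cut along the blocks and relabelled by its own ranks. Right to
    left, the parts are realized independently in their blocks, and [order_iso_flatten] shows that
    the pieces together form an occurrence, since comparisons across blocks depend on [r] only. *)
Lemma pattern_substP r ps s p : is_subst r ps s -> pattern_of p s <-> fits_in r ps p.
Proof.
move=> /is_substE[Ss [e sz n0 c] eps].
have uS i : uniq (nth [::] Ss i) by apply: flatten_nth_uniq; rewrite -e.
split.
  move=> /patternP[t [st t0 <-]].
  have ut : uniq t := subseq_uniq st (word_uniq s).
  move: st; rewrite e => /subseq_flattenP[ts [szt et H]].
  have mono i : {in nth [::] ts i &, {mono rank t : x y / x < y}}.
    by move=> x y xi yi; apply: rank_mono; rewrite et; apply/flatten_nthP; exists i.
  exists (map (map (rank t)) ts); split.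
  - by rewrite word_std // -map_flatten -et.
  - by rewrite size_map szt.
  - apply: compat_map; rewrite -?et ?szt //; first exact: rank_mono.
    by apply: (compat_subseq _ sz H c); rewrite szt.
  move=> i hi; have hi' : i < size ts by rewrite szt sz.
  rewrite (nth_map [::]) // => n; have n' : nth [::] ts i != [::].
    by rewrite -size_eq0 -(size_map (rank t)) size_eq0.
  rewrite -(eq_std (order_iso_map (mono i))) eps (nth_map [::]) ?sz //.
  exact: pattern_subseq.
move=> [ws [ew szw cw H]].
(* The part [ws_i] is a word of values of [p]; what is found in the block is a subsequence with the
   same relative order, and the empty one when [ws_i] is empty. *)
have E i : exists t, subseq t (nth [::] Ss i) /\ order_iso t (nth [::] ws i).
  have [n|n] := eqVneq (nth [::] ws i) [::].
    by exists [::]; rewrite sub0seq n.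
  have hi : i < size r by rewrite -szw; case: ltnP n => // h; rewrite nth_default.
  have := H i hi n; rewrite eps (nth_map [::]) ?sz // => /patternP[t [st t0 et]].
  have hS : nth [::] Ss i != [::] by apply: nth_neq_nil; rewrite ?sz.
  have oS := order_iso_std (uS i) hS.
  move: st; rewrite word_std // => /subseqP[m sm em].
  have em' := map_mask (rank (nth [::] Ss i)) m (nth [::] Ss i).
  rewrite -/(stdw _) -em in em'.
  exists (mask m (nth [::] Ss i)); split; first exact: mask_subseq.
  apply: (@order_iso_trans t).
    rewrite -em'; apply: order_iso_map => x y /mem_mask xm /mem_mask ym.
    exact: rank_mono.
  apply/std_eqP => //.
  - rewrite -em'; apply/(subseq_uniq (map_subseq _ (mask_subseq _ _))).
    exact: order_iso_uniq (order_iso_stdw _) (uS i).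
  - by apply: flatten_nth_uniq; rewrite ew.
have [f Hf] := choice E.
have szm : size (mkseq f (size r)) = size r by rewrite size_mkseq.
have Hf1 i : subseq (nth [::] (mkseq f (size r)) i) (nth [::] Ss i).
  have [hi|hi] := ltnP i (size r); first by rewrite nth_mkseq //; case: (Hf i).
  by rewrite nth_default ?szm // sub0seq.
apply/patternP; exists (flatten (mkseq f (size r))); split.
- by rewrite e; apply: flatten_subseq; rewrite ?szm ?sz.
- have : order_iso (flatten (mkseq f (size r))) (flatten ws).
    apply: (order_iso_flatten szm szw (compat_subseq szm sz Hf1 c) cw) => i.
    have [hi|hi] := ltnP i (size r); first by rewrite nth_mkseq //; case: (Hf i).
    by rewrite !nth_default ?szm ?szw.
  by move=> [e1 _]; rewrite -size_eq0 e1 ew size_eq0 word_neq0.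
rewrite -[RHS]stdK -ew; apply: eq_std.
apply: (order_iso_flatten szm szw (compat_subseq szm sz Hf1 c) cw) => i.
have [hi|hi] := ltnP i (size r); first by rewrite nth_mkseq //; case: (Hf i).
by rewrite !nth_default ?szm ?szw.
Qed.

Lemma pattern_subst_arg r ps s q : is_subst r ps s -> q \in ps -> pattern_of q s.
Proof.
move=> /is_substE[Ss [e sz n0 c] ->] /mapP[S SS ->].
rewrite -[s]stdK e; apply: pattern_subseq; first by rewrite -e.
  by apply: contraNneq n0 => <-.
case/splitPr: SS => a b; rewrite flatten_cat /=.
by apply: subseq_trans (suffix_subseq _ _); apply: prefix_subseq.
Qed.

(** The representatives [e i] are arbitrary: the arguments on simple roots need values other than
    the heads in a block that is cut in two. *)
Lemma heads_order_iso (r : permutation) Ss (e : nat -> nat) :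
  size Ss = size r -> compat r Ss -> (forall i, i < size r -> e i \in nth [::] Ss i) ->
  forall i j, i < size r -> j < size r -> (e i < e j) = (nth 0 r i < nth 0 r j).
Proof.
move=> sz c H i j hi hj; have [->|ij] := eqVneq i j; first by rewrite !ltnn.
by rewrite (compat_lt sz c (H i hi) (H j hj) ij).
Qed.

Lemma pattern_subst_root r ps s : is_subst r ps s -> pattern_of r s.
Proof.
move=> /is_substE[Ss [e sz n0 c] _].
exists (map (head 0) Ss); rewrite ?e.
  elim: Ss n0 {e sz c} => [|S Ss IH] //; rewrite in_cons negb_or => /andP[].
  case: S => // x S _ /IH h /=; rewrite eqxx; exact: subseq_trans h (suffix_subseq _ _).
split; first by rewrite size_map.
rewrite size_map => i j hi hj; rewrite !(nth_map [::]) //.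
apply: (heads_order_iso sz c (e := fun i => head 0 (nth [::] Ss i))); rewrite -?sz //.
by move=> k hk; apply: head_nth.
Qed.

Lemma blocks_root (r r' : permutation) Ss s : blocks r Ss s -> blocks r' Ss s -> r = r'.
Proof.
move=> [e sz n0 c] [_ sz' _ c']; apply: order_iso_perm; split; first by rewrite -sz sz'.
move=> i j; rewrite -sz => hi hj.
have h k : k < size Ss -> head 0 (nth [::] Ss k) \in nth [::] Ss k by apply: head_nth.
rewrite -(heads_order_iso sz c (e := fun i => head 0 (nth [::] Ss i))) -?sz //.
by rewrite -(heads_order_iso sz' c' (e := fun i => head 0 (nth [::] Ss i))) -?sz'.
Qed.

Lemma mem_slice (r : seq nat) a b v : a <= b <= size r ->
  reflect (exists2 i, a <= i < b & v = nth 0 r i) (v \in take (b - a) (drop a r)).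
Proof.
move=> ab; have sz : size (take (b - a) (drop a r)) = b - a.
  by rewrite size_takel // size_drop; slia.
apply: (iffP (nthP 0)) => [[i]|[i hi ->]]; rewrite sz.
  move=> hi <-; exists (a + i); first slia.
  by rewrite nth_take // nth_drop.
exists (i - a); first slia.
by rewrite nth_take ?nth_drop; [congr nth; slia|slia].
Qed.

(** If no outside value separates the values at positions from [a] to [b - 1], these values are
    convex: a value between two of them, placed at an outside position, would separate them. *)
Lemma module_interval (r : permutation) a b : a < b <= size r ->
  (forall x y z, a <= x < b -> a <= y < b -> z < size r -> ~~ (a <= z < b) ->
     nth 0 r x < nth 0 r z -> nth 0 r y < nth 0 r z) ->
  Defs.is_interval r a (b - a).
Proof.
move=> ab H; have ab' : a <= b <= size r by slia.
split; [slia|slia|].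
have ut : uniq (take (b - a) (drop a r)) by rewrite take_uniq ?drop_uniq.
apply: convex_consecutive => //.
  by rewrite -size_eq0 size_takel ?size_drop; slia.
move=> x y z /(mem_slice _ ab')[i hi ->] /(mem_slice _ ab')[k hk ->] xyz.
have yr : y \in word r.
  have : nth 0 r i \in word r by apply: mem_nth; slia.
  have : nth 0 r k \in word r by apply: mem_nth; slia.
  by rewrite !mem_perm_word //; slia.
have hj : index y (word r) < size r by rewrite index_mem.
have ey := nth_index 0 yr.
apply/(mem_slice _ ab'); exists (index y (word r)); last by rewrite ey.
apply: contraT => nj; have := H i k _ hi hk hj nj; rewrite ey; slia.
Qed.

Lemma simple_module r (e : nat -> nat) a b : simple_perm r ->
  (forall i j, i < size r -> j < size r -> (e i < e j) = (nth 0 r i < nth 0 r j)) ->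
  a < b <= size r ->
  (forall x y z, a <= x < b -> a <= y < b -> z < size r -> ~~ (a <= z < b) ->
     e x < e z -> e y < e z) ->
  b - a = 1 \/ b - a = size r.
Proof.
move=> [_ H] He ab M; apply: (H a); apply: module_interval => // x y z hx hy hz nz.
by rewrite -!He //; [apply: M|slia|slia].
Qed.

(** The boolean treats the roots [12] (for [true]) and [21] (for [false]) at once. *)
Definition ltd (d : bool) (x y : nat) : bool := if d then x < y else y < x.
Definition pd (d : bool) : permutation := if d then p12 else p21.

(** Both sides of the cut would be intervals, proper and hence of length 1, whereas [r] has size at
    least 4. *)
Lemma simple_no_cut d r (e : nat -> nat) j : simple_perm r ->
  (forall i j, i < size r -> j < size r -> (e i < e j) = (nth 0 r i < nth 0 r j)) ->
  0 < j < size r ->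
  (forall x z, x < j -> j <= z < size r -> ltd d (e x) (e z)) -> False.
Proof.
move=> sr He hj H; have [r4 _] := sr.
have [|x y z hx hy hz nz|h1|h1] := simple_module (a := 0) (b := j) sr He; try slia.
  by have := H x z; have := H y z; rewrite /ltd; case: d {H}; slia.
have [|x y z hx hy hz nz|h2|h2] := simple_module (a := j) (b := size r) sr He; try slia.
by have := H z x; have := H z y; rewrite /ltd; case: d {H}; slia.
Qed.

(** Locates the block [Y1 ++ Y2] in which [X] ends. [Y2] is empty when [X] ends with the block; [Y1]
    is not, so the head of this block always lies in [X]. *)
Lemma flatten_eq_cat (Ss : seq (seq nat)) X Z : flatten Ss = X ++ Z -> X != [::] ->
  exists L Y1 Y2 R, [/\ Ss = L ++ (Y1 ++ Y2) :: R, X = flatten L ++ Y1,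
    Z = Y2 ++ flatten R & Y1 != [::]].
Proof.
elim: Ss X => [|S Ss IH] X /=; first by case: X.
move=> e X0; have [h|h] := leqP (size X) (size S).
  exists [::], X, (drop (size X) S), Ss; split=> //=.
    by have := congr1 (take (size X)) e; rewrite takel_cat // take_size_cat // => {1}<-; rewrite cat_take_drop.
  have <- : drop (size X) (S ++ flatten Ss) = Z by rewrite e drop_size_cat.
  by rewrite -{1}(cat_take_drop (size X) S) -catA drop_size_cat ?size_takel.
have eX : X = S ++ drop (size S) X.
  have := congr1 (take (size S)) e; rewrite take_size_cat // takel_cat ?(ltnW h) // => {1}->.
  by rewrite cat_take_drop.
move: e; rewrite eX -catA => /eqP; rewrite eqseq_cat // eqxx /= => /eqP e.
have X'0 : drop (size S) X != [::] by rewrite -size_eq0 size_drop subn_eq0 -ltnNge.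
have [L [Y1 [Y2 [R [-> e2 -> Y10]]]]] := IH _ e X'0.
by exists (S :: L), Y1, Y2, R; split=> //=; rewrite e2 catA.
Qed.

(** A cut of [s] is transported to a cut of the simple root by choosing in each block a
    representative on the appropriate side. *)
Lemma simple_subst_no_cut d r Ss X Z : simple_perm r -> blocks r Ss (X ++ Z) ->
  X != [::] -> Z != [::] -> (forall x z, x \in X -> z \in Z -> ltd d x z) -> False.
Proof.
move=> sr [e sz n0 c] X0 Z0 H; have [r4 _] := sr.
have [L [Y1 [Y2 [R [eS eX eZ Y10]]]]] := flatten_eq_cat (esym e) X0.
have sS : size Ss = (size L + size R).+1 by rewrite eS size_cat /= addnS.
have hd i : i < size Ss -> head 0 (nth [::] Ss i) \in nth [::] Ss i by apply: head_nth.
have hX i : i <= size L -> head 0 (nth [::] Ss i) \in X.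
  move=> hi; have /hd : i < size Ss by slia.
  rewrite eX eS mem_cat nth_cat; case: ltnP => h.
    by move=> hh; apply/orP; left; apply/flatten_nthP; exists i.
  have -> : i - size L = 0 by slia.
  by case: (Y1) Y10 => //= y Y' _ _; rewrite mem_head orbT.
(* Some blocks lie after the one where [X] ends: the heads are good representatives, and the cut of
   [r] comes right after that block. *)
have [R0|R0] := eqVneq R [::]; last first.
  apply: (@simple_no_cut d r (fun i => head 0 (nth [::] Ss i)) (size L).+1) => //.
  - by apply: (heads_order_iso sz c) => i; rewrite -sz; apply: hd.
  - by move: R0; rewrite -size_eq0 -sz sS; slia.
  move=> x z hx hz; apply: H; first exact: hX.
  have /hd : z < size Ss by slia.
  rewrite {2}eS nth_cat; case: ltnP; first slia.
  case E : (z - size L) => [|k]; first slia.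
  move=> _ /= hh; rewrite eZ mem_cat; apply/orP; right; apply/flatten_nthP; by exists k.
(* [X] ends in the last block: this block is represented by a value of [Z], and the cut of [r] comes
   just before it. The left side is not empty because [r] has at least four entries. *)
subst R; move: eZ; rewrite cats0 => eZ; subst Y2.
apply: (@simple_no_cut d r (fun i => if i < size L then head 0 (nth [::] Ss i) else head 0 Z) (size L)) => //.
- apply: (heads_order_iso sz c) => i hi; case: ltnP => h; first by apply: hd; rewrite sz.
  rewrite eS nth_cat ltnNge h /=; have -> : i - size L = 0 by move: sS hi; rewrite /= -sz; slia.
  by rewrite /= mem_cat; case: (Z) Z0 => // z Z' _; rewrite mem_head orbT.
- by move: r4; rewrite -sz sS /=; slia.
move=> x z hx hz; rewrite hx ltnNge (proj1 (andP hz)) /=; apply: H; first by apply: hX; slia.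
by case: (Z) Z0 => // z' Z' _; rewrite mem_head.
Qed.

Lemma first_difference (Ss Ss' : seq (seq nat)) : flatten Ss = flatten Ss' ->
  [::] \notin Ss -> [::] \notin Ss' -> Ss = Ss' \/
  exists L X X' R R', [/\ Ss = L ++ X :: R, Ss' = L ++ X' :: R' &
    X ++ flatten R = X' ++ flatten R'] /\ size X <> size X'.
Proof.
elim: Ss Ss' => [|S Ss IH] [|S' Ss'] //=.
- by left.
- by rewrite in_cons negb_or; case: S'.
- by rewrite in_cons negb_or; case: S.
rewrite !in_cons !negb_or => e /andP[_ n0] /andP[_ n0'].
have [es|] := eqVneq (size S) (size S'); last first.
  by move=> /eqP ne; right; exists [::], S, S', Ss, Ss'.
move: e => /eqP; rewrite eqseq_cat // => /andP[/eqP<- /eqP e].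
have [->|[L [X [X' [R [R' [[-> -> h] ne]]]]]]] := IH _ e n0 n0'; first by left.
by right; exists (S :: L), X, X', R, R'.
Qed.

(** No outside value separates the values of [X'], a block of the other decomposition. Since [X']
    covers [X] and at least the head of the next block, it yields an interval of [r] of length at
    least 2, hence all of [r]. Changing the representative of the last block then yields an interval
    that misses exactly this block. *)
Lemma simple_block_maximal (r r' : permutation) Ss s L X X' R R' : simple_perm r -> 1 < size r' ->
  blocks r Ss s -> blocks r' (L ++ X' :: R') s -> Ss = L ++ X :: R ->
  X ++ flatten R = X' ++ flatten R' -> size X < size X' -> False.
Proof.
move=> sr r'2 [e sz n0 c] [e' sz' n0' c'] eS eX hX; have [r4 _] := sr.
have eX' : X' = X ++ drop (size X) X'.
  have := congr1 (take (size X)) eX; rewrite take_size_cat // takel_cat ?(ltnW hX) // => {1}->.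
  by rewrite cat_take_drop.
move: eX; rewrite eX' -catA => /eqP; rewrite eqseq_cat // eqxx /= => /eqP eW.
have W0 : drop (size X) X' != [::] by rewrite -size_eq0 size_drop subn_eq0 -ltnNge.
have [M [Y1 [Y2 [R1 [eR eW1 eR' Y10]]]]] := flatten_eq_cat eW W0.
rewrite eW1 in eX'.
have hd i : i < size Ss -> head 0 (nth [::] Ss i) \in nth [::] Ss i by apply: head_nth.
rewrite eR in eS.
have sS : size Ss = size L + (size M + size R1).+2 by rewrite eS size_cat /= size_cat /= !addnS.
(* The [size M + 2] blocks that meet [X'] are [X], those of [M], and the one that begins with
   [Y1]. *)
have hin i : size L <= i < size L + (size M).+2 -> head 0 (nth [::] Ss i) \in X'.
  move=> hi; have /hd : i < size Ss by slia.
  rewrite eX' eS nth_cat ltnNge (proj1 (andP hi)) /=.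
  case E : (i - size L) => [|k] /=; first by rewrite mem_cat => ->.
  rewrite nth_cat !mem_cat; case: ltnP => h.
    by move=> hh; apply/orP; right; apply/orP; left; apply/flatten_nthP; exists k.
  have -> : k - size M = 0 by slia.
  by case: (Y1) Y10 => //= y Y' _ _; rewrite mem_head !orbT.
have hout i : i < size Ss -> ~~ (size L <= i < size L + (size M).+2) ->
    head 0 (nth [::] Ss i) \in flatten L ++ flatten R'.
  move=> /[dup] his /hd; rewrite eS nth_cat mem_cat; case: ltnP => h.
    by move=> hh _; apply/orP; left; apply/flatten_nthP; exists i.
  case E : (i - size L) => [|k] /=; first slia.
  rewrite nth_cat; case: ltnP => h1; first slia.
  case E1 : (k - size M) => [|k'] /=; first slia.
  move=> hh _; apply/orP; right; rewrite eR' mem_cat; apply/orP; right.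
  by apply/flatten_nthP; exists k'.
(* Everything outside [X'] lies in other blocks of the second decomposition, where only the order of
   [r'] matters. *)
have mod x y z : x \in X' -> y \in X' -> z \in flatten L ++ flatten R' -> x < z -> y < z.
  move=> xX yX; have iX : nth [::] (L ++ X' :: R') (size L) = X' by rewrite nth_cat ltnn subnn.
  have h j : z \in nth [::] (L ++ X' :: R') j -> size L != j -> x < z -> y < z.
    by move=> zj ne; rewrite !(compat_lt sz' c' _ zj ne) ?iX.
  rewrite mem_cat => /orP[] /flatten_nthP[j zj].
    have hj := mem_nth_size zj; apply: (h j); last by rewrite neq_ltn hj orbT.
    by rewrite nth_cat hj.
  apply: (h (size L + j.+1)); last by slia.
  by rewrite nth_cat ltnNge leq_addr /= addKn.
have hd' i : i < size r -> head 0 (nth [::] Ss i) \in nth [::] Ss i.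
  by rewrite -sz; apply: hd.
have hord := heads_order_iso sz c hd'.
have [|x y z hx hy hz nz||] := simple_module (a := size L) (b := size L + (size M).+2) sr hord.
- by rewrite -sz; slia.
- by apply: mod; [apply: hin|apply: hin|apply: hout; rewrite ?sz].
- by slia.
rewrite -sz => h.
have L0 : L = [::] by apply/eqP; rewrite -size_eq0; slia.
have R10 : R1 = [::] by apply/eqP; rewrite -size_eq0; slia.
subst L R1; rewrite /= cats0 in eR' sS.
(* [X'] is not all of [s], since [r'] has at least two entries; what is left of [s] is [Y2]. *)
have Y20 : Y2 != [::].
  rewrite -eR'; case: (R') sz' n0' => [|S R2] /= szR'; first by rewrite -szR' in r'2.
  by rewrite !in_cons !negb_or => /and3P[_ + _]; case: (S).
(* The last block is now represented by a value of [Y2], outside [X']. The first [k] blocks form an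
   interval with [k = size r - 1], which is neither 1 nor [size r]. *)
pose k := (size M).+1.
have zY2 : head 0 Y2 \in Y2 by case: (Y2) Y20 => // z Z' _; rewrite mem_head.
have hd2 i : i < size r ->
    (if i < k then head 0 (nth [::] Ss i) else head 0 Y2) \in nth [::] Ss i.
  move=> hi; case: ltnP => hk; first exact: hd'.
  rewrite eS /=; case: i hi hk => // i hi; rewrite ltnS => hk /=.
  rewrite nth_cat ltnNge hk /=; have -> : i - size M = 0 by rewrite /k in hk; slia.
  by rewrite /= mem_cat zY2 orbT.
have hord2 := heads_order_iso sz c hd2.
have [|x y z|h2|h2] := simple_module (a := 0) (b := k) sr hord2; last 2 first.
- by move: h2; rewrite subn0 /k; slia.
- by move: h2; rewrite subn0 /k; slia.
- by rewrite /k; slia.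
move=> /andP[_ hx] /andP[_ hy] hz; rewrite /= -leqNgt => hk; rewrite hx hy (ltnNge z) hk /=.
apply: mod; try by apply: hin; move: hx hy; rewrite /k /=; slia.
by rewrite /= eR'.
Qed.

(** * The substitution decomposition *)

Lemma simple_blocks_uniq (r r' : permutation) Ss Ss' s :
  simple_perm r -> simple_perm r' ->
  blocks r Ss s -> blocks r' Ss' s -> Ss = Ss'.
Proof.
move=> sr sr' b b'; have [e sz n0 c] := b; have [e' sz' n0' c'] := b'.
have [r4 _] := sr; have [r4' _] := sr'.
have [//|[L [X [X' [R [R' [[eS eS' eX] ne]]]]]]] := first_difference (etrans (esym e) e') n0 n0'.
subst Ss Ss'; case: (ltngtP (size X) (size X')) => // h; exfalso.
  by apply: (simple_block_maximal sr _ b b' erefl eX h); apply: leq_trans r4'.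
by apply: (simple_block_maximal sr' _ b' b erefl (esym eX) h); apply: leq_trans r4.
Qed.

(** * Decompositions with root 12 or 21, as cuts of a word *)

Definition cut (d : bool) (s X Z : seq nat) : Prop :=
  [/\ s = X ++ Z, X != [::], Z != [::] &
    forall x z, x \in X -> z \in Z -> ltd d x z].

Lemma compat_pd d X Z :
  compat (pd d) [:: X; Z] <-> (forall x z, x \in X -> z \in Z -> ltd d x z).
Proof.
rewrite /compat /pd; case: d => /=; rewrite !andbT; split => [/allrelP //|H].
- by apply/allrelP.
- by move=> h x z xX zZ; apply: h.
by apply/allrelP => x y xZ yX; apply: H.
Qed.

Lemma subst_pdE d ps s :
  is_subst (pd d) ps s <->
  exists X Z, cut d (word s) X Z /\ ps = [:: std X; std Z].
Proof.
have s2 : size (pd d) = 2 by case: d.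
split.
  move=> /is_substE[Ss [e sz n0 c] ->]; move: sz e n0 c; rewrite s2.
  case: Ss => [|X [|Z []]] //= _; rewrite cats0 !in_cons !negb_or => e /and3P[X0 Z0 _] /compat_pd c.
  by exists X, Z; split=> //; split; rewrite // eq_sym.
move=> [X [Z [[e X0 Z0 c] ->]]]; apply/is_substE; exists [:: X; Z] => //.
split; rewrite //= ?cats0 //; last exact/compat_pd.
by rewrite !in_cons !(eq_sym [::]) (negbTE X0) (negbTE Z0).
Qed.

Lemma indecomposableP d s :
  indecomposable (pd d) s <-> (forall X Z, ~ cut d (word s) X Z).
Proof.
split=> [H X Z c|H [q1 [q2 /subst_pdE[X [Z [c _]]]]]]; last exact: H c.
by apply: H; exists (std X), (std Z); apply/subst_pdE; exists X, Z.
Qed.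

Lemma cut_std d X : uniq X -> X != [::] ->
  (exists Y Z, cut d X Y Z) <-> (exists Y Z, cut d (word (std X)) Y Z).
Proof.
move=> uX X0; rewrite word_std //; have rX := @rank_mono X.
split=> [[Y [Z [e Y0 Z0 c]]]|[Y [Z [e Y0 Z0 c]]]].
  exists (map (rank X) Y), (map (rank X) Z); split.
  - by rewrite /stdw {2}e map_cat.
  - by rewrite -size_eq0 size_map size_eq0.
  - by rewrite -size_eq0 size_map size_eq0.
  have sub : {subset Y <= X} /\ {subset Z <= X} by rewrite e; split=> x h; rewrite mem_cat h ?orbT.
  move=> _ _ /mapP[x xY ->] /mapP[z zZ ->]; have := c x z xY zZ.
  have xX := proj1 sub x xY; have zX := proj2 sub z zZ.
  by rewrite /ltd; case: d {c}; rewrite rX.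
have szY : size Y <= size X by rewrite -(size_map (rank X) X) -/(stdw X) e size_cat leq_addr.
have eY : Y = map (rank X) (take (size Y) X) by rewrite map_take -/(stdw X) e take_size_cat.
have eZ : Z = map (rank X) (drop (size Y) X) by rewrite map_drop -/(stdw X) e drop_size_cat.
exists (take (size Y) X), (drop (size Y) X); split.
- by rewrite cat_take_drop.
- by rewrite -size_eq0 -(size_map (rank X) (take _ _)) -eY size_eq0.
- by rewrite -size_eq0 -(size_map (rank X) (drop _ _)) -eZ size_eq0.
move=> x z xY zZ; have := c (rank X x) (rank X z); rewrite {1}eY {1}eZ.
move=> /(_ (map_f _ xY) (map_f _ zZ)).
by rewrite /ltd; case: d {c}; rewrite rX // ?(mem_take xY) ?(mem_drop zZ).
Qed.

Lemma indecomposable_std d X : uniq X -> X != [::] ->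
  indecomposable (pd d) (std X) <-> (forall Y Z, ~ cut d X Y Z).
Proof.
move=> uX X0; rewrite indecomposableP; split=> H Y Z c.
  have [h _] := cut_std d uX X0; have [|Y' [Z' c']] := h; first by exists Y, Z.
  exact: H c'.
have [_ h] := cut_std d uX X0; have [|Y' [Z' c']] := h; first by exists Y, Z.
exact: H c'.
Qed.

(** If the first part can be cut again, its second piece is moved to the right part; the first part
    gets shorter. *)
Lemma first_cut d (s : permutation) X Z : cut d s X Z ->
  exists Y W, cut d s Y W /\ indecomposable (pd d) (std Y).
Proof.
have [n] := ubnP (size X); elim: n X Z => // n IH X Z; rewrite ltnS => sX [e X0 Z0 c].
have uX : uniq X by have := word_uniq s; rewrite e cat_uniq => /andP[].
have [ind|] := pselect (indecomposable (pd d) (std X)); first by exists X, Z.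
rewrite indecomposable_std // => /existsNP[Y /existsNP[W /contrapT [eX Y0 W0 c']]].
apply: (IH Y (W ++ Z)).
  apply: leq_trans sX; rewrite eX size_cat.
  by rewrite -[X in X < _]addn0 ltn_add2l lt0n size_eq0.
split=> //; first by rewrite e eX catA.
  by case: (W) W0.
move=> x z xY; rewrite mem_cat => /orP[]; first exact: c'.
by apply: c; rewrite eX mem_cat xY.
Qed.

(** If one first part were longer, the shorter one would cut it in the same direction, against its
    indecomposability. *)
Lemma cut_uniq d (s : permutation) X Z X' Z' :
  cut d s X Z -> cut d s X' Z' ->
  indecomposable (pd d) (std X) -> indecomposable (pd d) (std X') -> X = X' /\ Z = Z'.
Proof.
move=> [e X0 Z0 c] [e' X0' Z0' c'].
have uX : uniq X by have := word_uniq s; rewrite e cat_uniq => /andP[].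
have uX' : uniq X' by have := word_uniq s; rewrite e' cat_uniq => /andP[].
rewrite !indecomposable_std // => i i'.
have key (A B C D : seq nat) : A ++ B = C ++ D -> size A < size C ->
   C = A ++ drop (size A) C /\ drop (size A) C != [::] /\ {subset drop (size A) C <= B}.
  move=> h sA; have eC : C = A ++ drop (size A) C.
    have := congr1 (take (size A)) h; rewrite take_size_cat // takel_cat ?(ltnW sA) //.
    by move=> {1}->; rewrite cat_take_drop.
  split=> //; split; first by rewrite -size_eq0 size_drop subn_eq0 -ltnNge.
  move: h; rewrite {1}eC -catA => /eqP; rewrite eqseq_cat // => /andP[_ /eqP->] x.
  by rewrite mem_cat => ->.
have ee : X ++ Z = X' ++ Z' by rewrite -e.
case: (ltngtP (size X) (size X')) => h.
- have [h1 [h2 h3]] := key _ _ _ _ ee h.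
  by case: (i' X (drop (size X) X')); split=> // x z xX /h3; apply: c.
- have [h1 [h2 h3]] := key _ _ _ _ (esym ee) h.
  by case: (i X' (drop (size X') X)); split=> // x z xX /h3; apply: c'.
by move/eqP: ee; rewrite eqseq_cat // => /andP[/eqP-> /eqP->].
Qed.

(** The first and last entries of [s] lie on different sides of every cut, so they determine its
    direction. *)
Lemma cut_disjoint d (s : permutation) X Z X' Z' :
  cut d s X Z -> cut (~~ d) s X' Z' -> False.
Proof.
move=> [e X0 Z0 c] [e' X0' Z0' c'].
have h A B : A != [::] -> word s = A ++ B -> head 0 s \in A.
  by case: A => // a A _ ->; rewrite mem_head.
have l A B : B != [::] -> word s = A ++ B -> last 0 s \in B.
  by case/lastP: B => // B b _ ->; rewrite last_cat last_rcons mem_rcons mem_head.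
have := c _ _ (h _ _ X0 e) (l _ _ Z0 e); have := c' _ _ (h _ _ X0' e') (l _ _ Z0' e').
by rewrite /ltd; case: d {c c'} => /=; slia.
Qed.

(* The product terms whose root and first component satisfy the uniqueness
   conditions of the decomposition theorem. *)
Definition canonical_root (r : permutation) (ps : seq permutation) : Prop :=
  (exists2 d, r = pd d & indecomposable (pd d) (nth p1 ps 0)) \/ simple_perm r.

Lemma pd_not_simple d : ~ simple_perm (pd d).
Proof. by case: d => -[]. Qed.

(** A cut excludes the opposite cut and every simple root, which settles the mixed cases. Two cuts
    in one direction agree by [cut_uniq]; two simple roots have the same blocks, and the blocks
    determine the root. *)
Lemma subst_uniq r r' ps ps' s : canonical_root r ps -> canonical_root r' ps' ->
  is_subst r ps s -> is_subst r' ps' s -> r = r' /\ ps = ps'.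
Proof.
move=> C C' h h'.
case: C => [[d ? i]|sr]; [subst r|]; (case: C' => [[d' ? i']|sr']; [subst r'|]).
- move: h h' => /subst_pdE[X [Z [c ?]]] /subst_pdE[X' [Z' [c' ?]]]; subst ps ps'.
  have [?|ne] := eqVneq d d'; last first.
    have ? : d' = ~~ d by case: d d' ne {i i' c c'} => [] [].
    by subst d'; case: (cut_disjoint c c').
  by subst d'; have [-> ->] := cut_uniq c c' i i'.
- move: h h' => /subst_pdE[X [Z [[e X0 Z0 c] _]]] /is_substE[Ss b _].
  by rewrite e in b; case: (simple_subst_no_cut sr' b X0 Z0 c).
- move: h' h => /subst_pdE[X [Z [[e X0 Z0 c] _]]] /is_substE[Ss b _].
  by rewrite e in b; case: (simple_subst_no_cut sr b X0 Z0 c).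
move: h h' => /is_substE[Ss b ->] /is_substE[Ss' b' ->].
have ? := simple_blocks_uniq sr sr' b b'; subst Ss'.
by rewrite (blocks_root b b').
Qed.

Lemma subst_indecomposable d r ps s : r = pd (~~ d) \/ simple_perm r ->
  is_subst r ps s -> indecomposable (pd d) s.
Proof.
move=> C h; apply/indecomposableP => X Z c; case: C => [?|sr].
  subst r; move/subst_pdE: h => [X' [Z' [c' _]]]; exact: cut_disjoint c c'.
move/is_substE: h => [Ss b _]; case: c => e X0 Z0 c.
by rewrite e in b; case: (simple_subst_no_cut sr b X0 Z0 c).
Qed.

(** * Existence of the decomposition *)

Lemma compat_order_iso (r r' : seq nat) Ss : order_iso r r' -> size Ss = size r ->
  compat r Ss -> compat r' Ss.
Proof.
move=> [sz H] sS /(compat_nthP sS) c; apply/compat_nthP; first by rewrite sS.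
move=> i j x y ij xi yj; apply: (c i j x y _ xi yj); rewrite H // -sS.
  exact: mem_nth_size xi.
exact: mem_nth_size yj.
Qed.

(** An interval of the root is collapsed to its first value [x0], and the corresponding blocks are
    concatenated. This works because an outside value is on the same side of all values of the
    interval. *)
Lemma merge_blocks (r : permutation) Ss s i l : blocks r Ss s ->
  Defs.is_interval r i l -> 1 < l < size r ->
  exists r' Ss', blocks r' Ss' s /\ size r' = (size r - l).+1.
Proof.
move=> [e sz n0 c] [_ il [m cm]] hl.
pose Mr := take l (drop i r); pose Lr := take i r; pose Rr := drop (i + l) r.
pose MS := take l (drop i Ss); pose LS := take i Ss; pose RS := drop (i + l) Ss.
have er : word r = Lr ++ Mr ++ Rr by rewrite /Mr /Lr /Rr addnC -drop_drop !cat_take_drop.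
have eS : Ss = LS ++ MS ++ RS by rewrite /MS /LS /RS addnC -drop_drop !cat_take_drop.
have szL : size Lr = size LS by rewrite !size_take sz.
have szMl : size Mr = l by rewrite size_takel // size_drop; slia.
have szM : size Mr = size MS by rewrite szMl size_takel // size_drop sz; slia.
have szR : size Rr = size RS by rewrite !size_drop sz.
have ur := word_uniq r; rewrite er in ur.
have hM : head 0 Mr \in Mr by case: (Mr) szMl => [/=|x M' _]; [slia|rewrite mem_head].
set x0 := head 0 Mr in hM.
pose r0 := Lr ++ x0 :: Rr; pose Ss' := LS ++ flatten MS :: RS.
have ur0 : uniq r0.
  move: ur; rewrite /r0 !cat_uniq /= => /and3P[-> h /and3P[_ h' ->]].
  rewrite /= andbT negb_or; apply/andP; split.
    apply/andP; split; first by move/hasPn: h; apply; rewrite mem_cat hM.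
    by apply: contra h => /hasP[x xR xL]; apply/hasP; exists x; rewrite // mem_cat xR orbT.
  by apply: contra h' => hx; apply/hasP; exists x0.
have side x y z : x \in Mr -> y \in Mr -> z \in Lr ++ Rr -> (x < z -> y < z) /\ (z < x -> z < y).
  rewrite !(perm_mem cm) !mem_iota => hx hy hz.
  have : z \notin Mr.
    move: ur; rewrite !cat_uniq => /and3P[_ h /and3P[_ h' _]]; apply/negP => zM.
    move: hz; rewrite mem_cat => /orP[zL|zR].
      by case/negP: h; apply/hasP; exists z; rewrite // mem_cat zM.
    by case/negP: h'; apply/hasP; exists z.
  by rewrite (perm_mem cm) mem_iota; slia.
have c0 : compat r0 Ss'.
  move/compatP: c => c; apply/compatP.
  have zr : zip r Ss = zip Lr LS ++ zip Mr MS ++ zip Rr RS by rewrite er eS !zip_cat.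
  have z0 : zip r0 Ss' = zip Lr LS ++ (x0, flatten MS) :: zip Rr RS by rewrite zip_cat.
  have inS u : u \in zip r0 Ss' -> u = (x0, flatten MS) \/ (u \in zip r Ss) /\ u.1 \in Lr ++ Rr.
    rewrite z0 zr !mem_cat in_cons => /or3P[h|/eqP->|h]; [right|by left|right].
      have := map_f fst h; rewrite -/(unzip1 _) unzip1_zip ?szL // => ->; by rewrite h.
    have := map_f fst h; rewrite -/(unzip1 _) unzip1_zip ?szR // => ->; by rewrite h !orbT.
  have inM x : x \in flatten MS -> exists v, [/\ v \in zip r Ss, v.1 \in Mr & x \in v.2].
    move=> /flatten_nthP[j xj]; have hj := mem_nth_size xj.
    exists (nth 0 Mr j, nth [::] MS j); split=> //=; last by rewrite mem_nth ?szM.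
    rewrite zr !mem_cat; apply/orP; right; apply/orP; left.
    by rewrite -nth_zip // mem_nth // size1_zip szM.
  move=> u v /inS hu /inS hv uv x y.
  case: hu hv uv => [->|[hu hu']] [->|[hv hv']] uv /=; rewrite ?ltnn // in uv *.
  - move=> /inM[w [hw wM xw]] yv; apply: (c w v) => //.
    by case: (side x0 w.1 v.1 hM wM hv') => h _; apply: h.
  - move=> xu /inM[w [hw wM yw]]; apply: (c u w) => //.
    by case: (side x0 w.1 u.1 hM wM hu') => _; apply.
  exact: c uv x y.
have r00 : r0 != [::] by rewrite /r0; case: (Lr).
have s0 : size Ss' = size r0 by rewrite !size_cat /= szL szR.
exists (std r0), Ss'; split; last first.
  by rewrite size_std // size_cat /= addnS -szMl er !size_cat; slia.
split.
- by rewrite e eS !flatten_cat /=.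
- by rewrite size_std.
- rewrite mem_cat in_cons !negb_or; move: n0; rewrite eS !mem_cat !negb_or => /and3P[-> h ->].
  rewrite /= andbT eq_sym; case: (MS) h szM => [|S M']; rewrite szMl /=; first by slia.
  by rewrite in_cons negb_or => /andP[h _] _; case: (S) h.
by apply: compat_order_iso c0 => //; apply: order_iso_std.
Qed.

Lemma size2_perm (r : permutation) : size r = 2 -> r = p12 \/ r = p21.
Proof.
move=> s2; have : word r \in permutations (iota 1 2).
  by rewrite mem_permutations -s2; have /andP[_] := word_perm r.
have -> : permutations (iota 1 2) = [:: [:: 1; 2]; [:: 2; 1]] by vm_compute.
by rewrite !inE => /orP[] /eqP h; [left|right]; apply: word_inj.
Qed.

Lemma size3_interval (r : permutation) : size r = 3 -> exists i, Defs.is_interval r i 2.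
Proof.
move=> s3; have : word r \in permutations (iota 1 3).
  by rewrite mem_permutations -s3; have /andP[_] := word_perm r.
have -> : permutations (iota 1 3) =
  [:: [:: 2; 1; 3]; [:: 1; 2; 3]; [:: 3; 1; 2]; [:: 1; 3; 2]; [:: 2; 3; 1]; [:: 3; 2; 1]] by vm_compute.
have I i m : i + 2 <= 3 -> perm_eq (take 2 (drop i (word r))) (iota m 2) -> Defs.is_interval r i 2.
  by move=> hi h; split; rewrite ?s3 //; exists m; rewrite (perm_size h) size_iota.
rewrite !inE; do 5?[case/orP]; move=> /eqP h; rewrite h in I.
- by exists 0; apply: (I 0 1).
- by exists 0; apply: (I 0 1).
- by exists 1; apply: (I 1 1).
- by exists 1; apply: (I 1 2).
- by exists 0; apply: (I 0 2).
by exists 0; apply: (I 0 2).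
Qed.

(** As long as the root has size at least 3 and is not simple, it has an interval along which blocks
    can be merged, and the new root is smaller but still has size at least 2. *)
Lemma exists_blocks (r : permutation) Ss s : blocks r Ss s -> 2 <= size r ->
  exists r' Ss', blocks r' Ss' s /\ ((exists d, r' = pd d) \/ simple_perm r').
Proof.
have [n] := ubnP (size r); elim: n r Ss => // n IH r Ss; rewrite ltnS => rn b r2.
have [sr|ns] := pselect (simple_perm r); first by exists r, Ss; split; [|right].
have [e2|n2] := eqVneq (size r) 2.
  exists r, Ss; split=> //; left.
  by have [->|->] := size2_perm e2; [exists true|exists false].
have [i [l [il l1 lk]]] : exists i l, [/\ Defs.is_interval r i l, l <> 1 & l <> size r].
  (* Size 3 is apart: [simple_perm] excludes it by its size condition, so an interval of length 2
     must be exhibited. *)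
  have [e3|n3] := eqVneq (size r) 3.
    by have [i hi] := size3_interval e3; exists i, 2; rewrite e3.
  apply: contrapT => H; apply: ns; split; first by slia.
  move=> i l il; apply: contrapT => h; apply: H; exists i, l; split=> // h'; apply: h; tauto.
have [l0 ill _] := il.
have hl : 1 < l < size r by slia.
have [r' [Ss' [b' sr']]] := merge_blocks b il hl.
by apply: (IH r' Ss') => //; rewrite sr'; slia.
Qed.

Lemma trivial_blocks (s : permutation) : blocks s [seq [:: x] | x <- word s] s.
Proof.
split; rewrite ?size_map //.
- by elim: (word s) => //= x w {1}->.
- by apply/mapP => -[].
apply/compat_nthP; first by rewrite size_map.
move=> i j x y ij xi yj; have hi := mem_nth_size xi; have hj := mem_nth_size yj.
rewrite size_map in hi hj; rewrite !(nth_map 0) // !mem_seq1 in xi yj.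
by rewrite (eqP xi) (eqP yj).
Qed.

Lemma exists_subst (s : permutation) : 2 <= size s ->
  exists r ps, is_subst r ps s /\ canonical_root r ps.
Proof.
move=> s2; have [r [Ss [b [[d ?]|sr]]]] := exists_blocks (trivial_blocks s) s2.
  subst r; have : is_subst (pd d) (map std Ss) s by apply/is_substE; exists Ss.
  move=> /subst_pdE[X [Z [c _]]]; have [Y [W [c' ind]]] := first_cut c.
  exists (pd d), [:: std Y; std W]; split; first by apply/subst_pdE; exists Y, W.
  by left; exists d.
exists r, (map std Ss); split; last by right.
by apply/is_substE; exists Ss.
Qed.

Lemma size_subst_arg r ps s q : is_subst r ps s -> 1 < size r -> q \in ps -> size q < size s.
Proof.
move=> h r2 qs; rewrite (size_subst h); have := size_subst_args h.
case/splitPr: qs h => a b _; rewrite size_cat /= => sz.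
rewrite map_cat sumn_cat /= addnCA -[X in X < _]addn0 ltn_add2l -sumn_cat -map_cat.
have : a ++ b != [::] by rewrite -size_eq0 size_cat; slia.
by case: (a ++ b) => //= p t _; rewrite addn_gt0 size_word_gt0.
Qed.

Lemma canonical_root_size r ps : canonical_root r ps -> 1 < size r.
Proof. by case=> [[[] -> _]|[h _]] //; apply: leq_trans h. Qed.

(** * The specification *)

Fixpoint cart (T : Type) (ls : seq (seq T)) : seq (seq T) :=
  if ls is l :: ls' then flatten [seq [seq x :: y | y <- cart ls'] | x <- l]
  else [:: [::]].

Lemma mem_cart (T : eqType) (x0 : T) (ls : seq (seq T)) y :
  reflect (size y = size ls /\
           forall k, k < size ls -> nth x0 y k \in nth [::] ls k)
          (y \in cart ls).
Proof.
elim: ls y => [|l ls IH] y /=.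
  by rewrite mem_seq1; apply: (iffP eqP) => [->|[]] //; case: y.
apply: (iffP allpairsPdep) => [[x [z [xl /IH[sz H] ->]]]|[]].
  by split=> /= [|[|k]] //; [rewrite sz|apply: H].
case: y => // x y [sz] H; exists x, y; split=> //; first exact: (H 0).
by apply/IH; split=> // k hk; apply: (H k.+1).
Qed.

Lemma uniq_cart (T : eqType) (ls : seq (seq T)) : all uniq ls -> uniq (cart ls).
Proof.
elim: ls => //= l ls IH /andP[ul /IH uc].
by apply: allpairs_uniq => // -[x y] [x' y'] _ _ /= [-> ->].
Qed.

Lemma map_cart (T U : Type) (f : T -> U) (ls : seq (seq T)) :
  map (map f) (cart ls) = cart (map (map f) ls).
Proof.
elim: ls => //= l ls <-; rewrite map_flatten -!map_comp; congr flatten.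
by apply: eq_map => x /=; rewrite -!map_comp.
Qed.

Definition patterns (B : seq permutation) : seq permutation :=
  undup (flatten (map pats B)).

Lemma patternsP B p : reflect (exists2 b, b \in B & pattern_of p b) (p \in patterns B).
Proof.
rewrite mem_undup; apply: (iffP flatten_mapP) => [[b bB /mem_pats h]|[b bB /mem_pats h]];
  by exists b.
Qed.

Lemma patterns_down B p q : pattern_of q p -> p \in patterns B -> q \in patterns B.
Proof.
by move=> qp /patternsP[b bB pb]; apply/patternsP; exists b => //; apply: pattern_trans pb.
Qed.

Definition type_of (P : seq permutation) (s : permutation) : seq permutation :=
  [seq p <- P | p \in pats s].

Lemma mem_type_of P s p : reflect (p \in P /\ pattern_of p s) (p \in type_of P s).
Proof.
by rewrite mem_filter andbC; apply: (iffP andP) => -[-> /mem_pats].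
Qed.

(** Decides [fits_in] from the types of the components alone. The parts are subsequences of [p], so
    finitely many [ws] are tried; an empty part imposes nothing on its component. *)
Definition fits (r : permutation) (Ts : seq (seq permutation)) (p : permutation) : bool :=
  has (fun ws => [&& flatten ws == word p, compat (word r) ws &
         all (fun u => (u.1 == [::]) || (std u.1 \in u.2)) (zip ws Ts)])
    (cart [seq subs (word p) | _ <- word r]).

Lemma infix_flatten (ws : seq (seq nat)) i : subseq (nth [::] ws i) (flatten ws).
Proof.
elim: ws i => [|w ws IH] [|i] //=; first exact: prefix_subseq.
exact: subseq_trans (IH i) (suffix_subseq _ _).
Qed.

Lemma fitsP P (r : permutation) ps p : size ps = size r ->
  (forall q, pattern_of q p -> q \in P) ->
  reflect (fits_in r ps p) (fits r (map (type_of P) ps) p).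
Proof.
move=> sz HP; apply: (iffP hasP) => [[ws /(mem_cart [::])[]]|[ws [ew sw cw H]]].
  rewrite size_map => sw _ /and3P[/eqP ew cw /allP H]; exists ws; split=> // i hi n.
  have : (nth [::] ws i, nth [::] (map (type_of P) ps) i) \in zip ws (map (type_of P) ps).
    by rewrite -nth_zip ?size_map ?sw ?sz // mem_nth // size1_zip ?size_map ?sw ?sz.
  move=> /H /=; rewrite (negbTE n) /= (nth_map p1) ?sz //.
  by move=> /mem_type_of[].
exists ws.
  apply/(mem_cart [::]); rewrite size_map; split=> // k hk.
  by rewrite (nth_map 0) // mem_subs -ew infix_flatten.
rewrite ew eqxx cw /=; apply/allP => u /(nthP ([::], [::]))[i].
rewrite size1_zip ?size_map ?sw ?sz // => hi <-.
rewrite nth_zip ?size_map ?sw ?sz //= (nth_map p1) ?sz //.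
case: eqVneq => //= n; apply/mem_type_of; split; last exact: H.
apply: HP; rewrite -[p]stdK -ew; apply: pattern_subseq => //.
  by rewrite ew.
exact: infix_flatten.
Qed.

(** Types are subsequences of the duplicate-free list [P], so equal sets of patterns are equal lists
    and types can be compared with [==]. *)
Definition safe_types (B P : seq permutation) : seq (seq permutation) :=
  [seq T <- subs P | ~~ has (fun b => b \in T) B].

Definition start (m : nat) (e : epsilon) : nat :=
  match e with EpsBlank => 1 | EpsPlus => m.+1 | EpsMinus => (m + m).+1 end.

Definition states (Ts : seq (seq permutation)) (e : epsilon) :
    seq (nat * seq permutation) :=
  zip (iota (start (size Ts) e) (size Ts)) Ts.

(** For the roots [12] and [21] the first component must be indecomposable, which is what makes the
    decomposition unique. *)
Definition arg_eps (r : permutation) : seq epsilon :=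
  if r == p12 then [:: EpsPlus; EpsBlank]
  else if r == p21 then [:: EpsMinus; EpsBlank]
  else [seq EpsBlank | _ <- word r].

(** [undup] because the input list may repeat a simple permutation, which would duplicate terms. *)
Definition root_list (S : seq permutation) (e : epsilon) : seq permutation :=
  match e with EpsPlus => [::] | _ => [:: p12] end ++
  match e with EpsMinus => [::] | _ => [:: p21] end ++ undup S.

(* [None] stands for the atom, [Some (r, args)] for [Inflate r args]; the second
   component is the common type of the permutations that the term produces. *)
Definition root_candidates (P : seq permutation) (Ts : seq (seq permutation))
    (r : permutation) : seq (option (permutation * seq nat) * seq permutation) :=
  [seq (Some (r, map fst tup), [seq p <- P | fits r (map snd tup) p])
     | tup <- cart (map (states Ts) (arg_eps r))].

Definition candidates (S P : seq permutation) (Ts : seq (seq permutation))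
    (e : epsilon) : seq (option (permutation * seq nat) * seq permutation) :=
  (None, [seq p <- P | p == p1]) ::
  flatten (map (root_candidates P Ts) (root_list S e)).

(** Options of pairs come with decidable equality, which membership and [uniq] require of the
    keys. *)
Definition to_term (k : option (permutation * seq nat)) : term :=
  if k is Some (r, args) then Inflate r args else Atom.

(** A term is an atom or a product with a root, so the class cannot be written directly as a union
    of other sets of the system; the terms of the states with blank constraint are listed
    instead. *)
Definition union_equation (B S P : seq permutation) (Ts : seq (seq permutation)) : equation :=
  Equation (Restriction EpsBlank B [::])
    [seq to_term c.1 | c <- candidates S P Ts EpsBlank & ~~ has (fun b => b \in c.2) B].

Definition state_equation (S P : seq permutation) (Ts : seq (seq permutation))
    (e : epsilon) (T : seq permutation) : equation :=
  Equation (Restriction e [seq p <- P | p \notin T] T)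
    [seq to_term c.1 | c <- candidates S P Ts e & c.2 == T].

Definition spec_with (B S P : seq permutation) (Ts : seq (seq permutation)) : specification :=
  union_equation B S P Ts ::
  map (state_equation S P Ts EpsBlank) Ts ++
  map (state_equation S P Ts EpsPlus) Ts ++
  map (state_equation S P Ts EpsMinus) Ts.

Definition spec_of (B S : seq permutation) : specification :=
  let P := patterns B in spec_with B S P (safe_types B P).

(** * Correctness of the equations *)

Section Specification.
Variables B S : seq permutation.
Hypothesis HS : forall s : permutation, s \in S <-> simple_perm s /\ Av B s.

Let P := patterns B.
Let Ts := safe_types B P.
Let C := Av B.
Let sp := spec_of B S.
Let X := spec_set C sp.

Lemma uniq_safe_types : uniq Ts.
Proof. by apply/filter_uniq/uniq_subs/undup_uniq. Qed.

Lemma size_spec : size sp = (size Ts + (size Ts + size Ts)).+1.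
Proof. by rewrite /= !size_cat !size_map. Qed.

Lemma states_fst e : map fst (states Ts e) = iota (start (size Ts) e) (size Ts).
Proof. by apply: unzip1_zip; rewrite size_iota. Qed.

Lemma mem_states e i T : (i, T) \in states Ts e ->
  [/\ 0 < i < size sp, T \in Ts & eq_nth sp i = state_equation S P Ts e T].
Proof.
move=> /(nthP (0, [::]))[k]; rewrite size1_zip ?size_iota // => hk.
rewrite nth_zip ?size_iota // nth_iota // => -[<- eT].
split; first by rewrite size_spec; case: e => /=; slia.
  by rewrite -eT mem_nth.
rewrite /eq_nth /sp /spec_of -/P /spec_with -/Ts; case: e => /=.
- by rewrite nth_cat size_map add0n hk (nth_map [::]) // eT.
- rewrite !nth_cat !size_map ltnNge leq_addr /= addKn hk.
  by rewrite (nth_map [::]) // eT.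
rewrite -addnA !nth_cat !size_map ltnNge leq_addr /= addKn ltnNge leq_addr /=.
by rewrite addKn (nth_map [::]) // eT.
Qed.

Lemma states_onto e T : T \in Ts -> exists i, (i, T) \in states Ts e.
Proof.
move=> /(nthP [::])[k hk <-].
exists (nth 0 (iota (start (size Ts) e) (size Ts)) k).
by rewrite -nth_zip ?size_iota // mem_nth // size1_zip ?size_iota.
Qed.

Lemma states_inj e i i' T : (i, T) \in states Ts e -> (i', T) \in states Ts e -> i = i'.
Proof.
move=> /(nthP (0, [::]))[k]; rewrite size1_zip ?size_iota // => hk.
rewrite nth_zip ?size_iota // nth_iota // => -[<- eT].
move=> /(nthP (0, [::]))[k']; rewrite size1_zip ?size_iota // => hk'.
rewrite nth_zip ?size_iota // nth_iota // => -[<- eT'].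
by congr addn; apply/eqP; rewrite -(nth_uniq [::] hk hk' uniq_safe_types) eT eT'.
Qed.

Lemma index_cases i : i < size sp -> i = 0 \/ exists e T, (i, T) \in states Ts e.
Proof.
rewrite size_spec; case: i => [|i] hi; first by left.
right; have E e k : k < size Ts -> start (size Ts) e + k = i.+1 ->
   exists T, (i.+1, T) \in states Ts e.
  move=> hk <-; exists (nth [::] Ts k).
  rewrite -(@nth_iota 0 (start (size Ts) e) (size Ts) k) // -nth_zip ?size_iota // mem_nth //.
  by rewrite size1_zip ?size_iota.
have [h|h] := ltnP i (size Ts).
  by exists EpsBlank; apply: (E EpsBlank i) => //=; slia.
have [h'|h'] := ltnP i (size Ts + size Ts).
  by exists EpsPlus; apply: (E EpsPlus (i - size Ts)) => /=; slia.
by exists EpsMinus; apply: (E EpsMinus (i - (size Ts + size Ts))) => /=; slia.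
Qed.

Lemma state_set e i T s : (i, T) \in states Ts e ->
  X i s <-> closure_eps C e s /\ type_of P s = T.
Proof.
move=> /mem_states[_ TT ei]; rewrite /X /spec_set /restr_set ei /=.
have sT : subseq T P by move: TT; rewrite mem_filter mem_subs => /andP[].
split=> [[c av co]|[c eT]]; split=> //.
(* Being a subsequence of the duplicate-free [P], the list [T] is [P] filtered by membership in [T],
   the same form as [type_of]. *)
- rewrite (subseq_uniqP _ sT) ?undup_uniq //; apply/eq_in_filter => p pP.
  apply/mem_pats/idP => [h|]; last exact: co.
  by apply/negPn/negP => n; apply: av h; rewrite mem_filter n.
- move=> p; rewrite mem_filter -eT => /andP[n pP] h.
  by move/mem_type_of: n; apply.
by move=> p; rewrite -eT => /mem_type_of[].
Qed.

Lemma avoids_type s : (C s) <-> ~~ has (fun b => b \in type_of P s) B.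
Proof.
split=> [H|/hasPn H b bB h].
  by apply/hasPn => b bB; apply/mem_type_of => -[_]; apply: H.
case/mem_type_of: (H b bB); split=> //; apply/patternsP; exists b => //.
exact: pattern_refl.
Qed.

Lemma C_down s q : pattern_of q s -> C s -> C q.
Proof. by move=> h H b bB h'; apply: H bB _; apply: pattern_trans h' h. Qed.

(** The root and the components of a decomposition are patterns of the whole, so they stay in the
    class. *)
Lemma Av_closure s : C s -> subst_closure C s.
Proof.
have [n] := ubnP (size s); elim: n s => // n IH s; rewrite ltnS => sn Cs.
have [s1|s2] := leqP (size s) 1.
  by apply: sc_leaf; have := size_word_gt0 s; slia.
have [r [ps [h c]]] := exists_subst s2.
have sub q : q \in ps -> subst_closure C q.
  move=> qs; apply: IH; last exact: C_down (pattern_subst_arg h qs) Cs.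
  exact: leq_trans (size_subst_arg h (canonical_root_size c) qs) sn.
case: c => [[d ? i]|sr]; last first.
  by apply: (sc_simple sr _ h sub); apply: C_down (pattern_subst_root h) Cs.
subst r; have := size_subst_args h; case: ps h i sub => [|q1 [|q2 [|]]] h i sub; try by case: (d).
move=> _; case: d h i => h i; [apply: sc_plus h i _ _|apply: sc_minus h i _ _];
  by apply: sub; rewrite !inE eqxx ?orbT.
Qed.

Lemma size_arg_eps r : size (arg_eps r) = size r.
Proof. by rewrite /arg_eps; do 2![case: eqVneq => [->|_] //]; rewrite size_map. Qed.

Lemma arg_eps_simple r : simple_perm r -> arg_eps r = [seq EpsBlank | _ <- word r].
Proof.
rewrite /arg_eps; case: eqVneq => [->|_]; first by move/(@pd_not_simple true).
by case: eqVneq => [->|//]; move/(@pd_not_simple false).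
Qed.

Lemma mem_S_simple r : r \in undup S -> simple_perm r.
Proof. by rewrite mem_undup => /HS[]. Qed.

Lemma root_list_cases e r : r \in root_list S e ->
  [\/ r = p12 /\ e <> EpsPlus, r = p21 /\ e <> EpsMinus | r \in undup S].
Proof.
rewrite /root_list !mem_cat => /or3P[]; last by constructor 3.
  by case: e => //; rewrite mem_seq1 => /eqP ->; constructor 1.
by case: e => //; rewrite mem_seq1 => /eqP ->; constructor 2.
Qed.

Lemma closure_inv e s : closure_eps C e s -> s = p1 \/ exists r ps,
  [/\ is_subst r ps s, r \in root_list S e &
     forall k, k < size r -> closure_eps C (nth EpsBlank (arg_eps r) k) (nth p1 ps k)].
Proof.
have cl : closure_eps C e s -> subst_closure C s by case: e => [|[]|[]].
move=> ce; have h := cl ce; move: ce {cl}.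
case: s / h => [s s1|q1 q2 s hs i h1 h2|q1 q2 s hs i h1 h2|r ps s sr Cr hs hq] ce.
- by left; apply: perm_size1.
- right; exists p12, [:: q1; q2]; split=> //.
    rewrite /root_list; case: e ce => //= -[_ n]; case: n; by exists q1, q2.
  by move=> [|[|k]].
- right; exists p21, [:: q1; q2]; split=> //.
    rewrite /root_list; case: e ce => [_|_|[_ n]]; rewrite /= ?in_cons ?eqxx ?orbT //.
    by case: n; exists q1, q2.
  by move=> [|[|k]].
right; exists r, ps; split=> //.
  by rewrite /root_list !mem_cat mem_undup; apply/or3P/Or33/HS.
move=> k hk; rewrite arg_eps_simple // (nth_map 0) //=.
by apply/hq/mem_nth; rewrite (size_subst_args hs).
Qed.

Lemma closure_intro e r ps s : is_subst r ps s -> r \in root_list S e ->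
  (forall k, k < size r -> closure_eps C (nth EpsBlank (arg_eps r) k) (nth p1 ps k)) ->
  closure_eps C e s.
Proof.
move=> h re H.
have cl : subst_closure C s.
  have sz := size_subst_args h; have h' := h.
  case/root_list_cases: re => [[? _]|[? _]|rS]; try subst r.
  - move: sz H h; case: ps h' => [|q1 [|q2 []]] // _ _ H h.
    by apply: sc_plus h _ _ _; [case: (H 0)|case: (H 0)|apply: (H 1)].
  - move: sz H h; case: ps h' => [|q1 [|q2 []]] // _ _ H h.
    by apply: sc_minus h _ _ _; [case: (H 0)|case: (H 0)|apply: (H 1)].
  have sr := mem_S_simple rS; move: rS; rewrite mem_undup => /HS[_ Cr].
  apply: (sc_simple sr Cr h) => q /(nthP p1)[k]; rewrite sz => hk <-.
  by have := H k hk; rewrite arg_eps_simple // (nth_map 0).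
case: e re => re /=; first exact: cl.
- split=> //; apply: (@subst_indecomposable true r ps) => //.
  by case/root_list_cases: re => [[]|[]|/mem_S_simple] //; [left|right].
split=> //; apply: (@subst_indecomposable false r ps) => //.
by case/root_list_cases: re => [[]|[]|/mem_S_simple] //; [left|right].
Qed.

Lemma root_canonical e r ps : r \in root_list S e ->
  (forall k, k < size r -> closure_eps C (nth EpsBlank (arg_eps r) k) (nth p1 ps k)) ->
  canonical_root r ps.
Proof.
move=> /root_list_cases[[? _]|[? _]|/mem_S_simple]; try subst r; last by right.
- by move=> /(_ 0 isT)[_ i]; left; exists true.
by move=> /(_ 0 isT)[_ i]; left; exists false.
Qed.

Lemma type_subst r ps s : is_subst r ps s ->
  type_of P s = [seq p <- P | fits r (map (type_of P) ps) p].
Proof.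
move=> h; apply/eq_in_filter => p pP; have sz := size_subst_args h.
have hq q : pattern_of q p -> q \in P by move=> qp; apply: patterns_down pP.
apply/mem_pats/fitsP => // [/(pattern_substP _ h) //|f].
exact/(pattern_substP _ h).
Qed.

Lemma type_p1 : type_of P p1 = [seq p <- P | p == p1].
Proof.
apply: eq_filter => p; apply/mem_pats/eqP => [[t st [sz _]]|->]; last exact: pattern_refl.
apply: perm_size1; have := size_subseq st; have := size_word_gt0 p; rewrite -sz /=; slia.
Qed.

Lemma mem_root_candidates r c : c \in root_candidates P Ts r <->
  exists tup, [/\ c = (Some (r, map fst tup), [seq p <- P | fits r (map snd tup) p]),
    size tup = size r &
    forall k, k < size r -> nth (0, [::]) tup k \in states Ts (nth EpsBlank (arg_eps r) k)].
Proof.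
split=> [/mapP[tup /(mem_cart (0, [::]))[]]|[tup [-> sz H]]].
  rewrite size_map size_arg_eps => sz H ->; exists tup; split=> // k hk.
  by have := H k hk; rewrite (nth_map EpsBlank) // size_arg_eps.
apply: map_f; apply/(mem_cart (0, [::])); rewrite size_map size_arg_eps; split=> // k hk.
by rewrite (nth_map EpsBlank) ?size_arg_eps //; apply: H.
Qed.

Lemma produces_state (r : permutation) tup ps s : size tup = size r ->
  (forall k, k < size r -> nth (0, [::]) tup k \in states Ts (nth EpsBlank (arg_eps r) k)) ->
  produces X (Inflate r (map fst tup)) ps s <->
  [/\ is_subst r ps s,
      forall k, k < size r -> closure_eps C (nth EpsBlank (arg_eps r) k) (nth p1 ps k) &
      map (type_of P) ps = map snd tup].
Proof.
move=> sz H.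
have M k q : k < size r -> X (nth 0 (map fst tup) k) q <->
    closure_eps C (nth EpsBlank (arg_eps r) k) q /\ type_of P q = nth [::] (map snd tup) k.
  move=> hk; rewrite (nth_map (0, [::])) ?sz // (nth_map (0, [::])) ?sz //.
  by apply: state_set; rewrite -surjective_pairing; apply: H.
rewrite /produces size_map sz; split=> [[szp Hk h]|[h Hk e]].
  split=> // [k hk|]; first by have /(M _ _ hk)[] := Hk k hk.
  apply: (@eq_from_nth _ [::]); rewrite !size_map ?szp // => k hk.
  by rewrite (nth_map p1) ?szp //; have /(M _ _ hk)[] := Hk k hk.
have szp := size_subst_args h; split=> // k hk; apply/(M _ _ hk); split; first exact: Hk.
by rewrite -e (nth_map p1) ?szp.
Qed.

Section Equation.
Variables (e : epsilon) (acc : pred (seq permutation)).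
Hypothesis acc_safe : forall T, acc T -> ~~ has (fun b => b \in T) B.

(** [acc] tells which types are accepted: all safe ones in the equation of the class, a single one
    in a state equation. Both kinds are thus treated together. *)
Let keys := [seq c.1 | c <- candidates S P Ts e & acc c.2].
Let rhs_e := map to_term keys.
Let Y := [set s | closure_eps C e s /\ acc (type_of P s)]%classic.

Lemma mem_keys_some r args : Some (r, args) \in keys <-> exists tup,
  [/\ args = map fst tup, r \in root_list S e, size tup = size r,
    forall k, k < size r -> nth (0, [::]) tup k \in states Ts (nth EpsBlank (arg_eps r) k) &
    acc [seq p <- P | fits r (map snd tup) p]].
Proof.
split=> [/mapP[c hc ec]|[tup [-> re sz H a]]].
  move: hc; rewrite mem_filter in_cons => /andP[a /orP[/eqP e'|]].
    by rewrite e' in ec.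
  move=> /flatten_mapP[r' re /mem_root_candidates[tup [ec' sz H]]]; subst c.
  by case: ec => ? ?; subst r args; exists tup.
apply/mapP; exists (Some (r, map fst tup), [seq p <- P | fits r (map snd tup) p]) => //.
rewrite mem_filter /= a in_cons /=; apply/flatten_mapP; exists r => //.
by apply/mem_root_candidates; exists tup.
Qed.

Lemma mem_keys_none : (None \in keys) = acc (type_of P p1).
Proof.
rewrite type_p1; apply/mapP/idP => [[c]|a]; last first.
  by exists (None, [seq p <- P | p == p1]) => //; rewrite mem_filter mem_head a.
rewrite mem_filter in_cons => /andP[a /orP[/eqP ec|/flatten_mapP[r' re]]]; first by rewrite ec in a.
by move=> /mem_root_candidates[tup [-> _ _]].
Qed.

Lemma keysP s : Y s <-> exists k ps, k \in keys /\ produces X (to_term k) ps s.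
Proof.
split=> [[ce a]|[[[r args]|] [ps []]]].
- case/closure_inv: ce => [e1|[r [ps [h re H]]]].
    by exists None, [::]; rewrite mem_keys_none -e1.
  have sz := size_subst_args h.
  (* An accepted type is safe, so [s] is in the class; hence so is [q], and the type of [q] is among
     the states. *)
  have safe q : q \in ps -> type_of P q \in Ts.
    move=> qs; rewrite mem_filter mem_subs filter_subseq andbT.
    apply/avoids_type/(C_down (pattern_subst_arg h qs))/avoids_type; exact: acc_safe.
  have F k : exists T : nat * seq permutation, k < size r ->
      T \in states Ts (nth EpsBlank (arg_eps r) k) /\ T.2 = type_of P (nth p1 ps k).
    have [hk|] := ltnP k (size r); last by exists (0, [::]).
    have [|i hi] := @states_onto (nth EpsBlank (arg_eps r) k) (type_of P (nth p1 ps k)).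
      by apply/safe/mem_nth; rewrite sz.
    by exists (i, type_of P (nth p1 ps k)).
  have [f Hf] := choice F.
  have [tup szt ntup] : exists2 tup, size tup = size r &
      forall k, k < size r -> nth (0, [::]) tup k = f k.
    by exists (mkseq f (size r)) => [|k hk]; rewrite ?size_mkseq ?nth_mkseq.
  have Ht k : k < size r -> nth (0, [::]) tup k \in states Ts (nth EpsBlank (arg_eps r) k).
    by move=> hk; rewrite ntup //; case: (Hf k hk).
  have et : map (type_of P) ps = map snd tup.
    apply: (@eq_from_nth _ [::]) => [|k]; rewrite !size_map ?szt // sz => hk.
    rewrite (nth_map p1) ?sz // (nth_map (0, [::])) ?szt // ntup //.
    by case: (Hf k hk).
  exists (Some (r, map fst tup)), ps; split; last by apply: (proj2 (@produces_state r tup ps s szt Ht)).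
  by apply/mem_keys_some; exists tup; split=> //; rewrite -et -(type_subst h).
- move=> /mem_keys_some[tup [-> re sz H a]] /(produces_state _ _ sz H)[h Hk et].
  by split; [apply: closure_intro h re Hk|rewrite (type_subst h) et].
move=> /[swap] -[_ ->]; rewrite mem_keys_none => a; split=> //.
have cl := @sc_leaf C p1 erefl.
by case: (e) => //=; split => //;
  move=> [q1 [q2 h]]; have := size_subst h; have := size_word_gt0 q1; have := size_word_gt0 q2;
  rewrite /=; slia.
Qed.

(** [subst_uniq] gives the root and the components; the components determine their types, and a type
    together with its constraint determines the index of the state. *)
Lemma keys_unambiguous s k k' ps ps' : k \in keys -> k' \in keys ->
  produces X (to_term k) ps s -> produces X (to_term k') ps' s -> k = k' /\ ps = ps'.
Proof.
(* An inflation with at least two components is larger than each of them, so it cannot be [p1]. *)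
have no r args q : Some (r, args) \in keys -> produces X (to_term (Some (r, args))) q p1 -> False.
  move=> /mem_keys_some[tup [-> re sz H a]] /(produces_state _ _ sz H)[h Hk et].
  have := size_subst_arg h (canonical_root_size (root_canonical re Hk)).
  have := size_subst_args h; have := size_word_gt0 r; case: q {h Hk et} => [|x q] /=; first slia.
  by move=> _ _ /(_ x (mem_head _ _)); have := size_word_gt0 x; rewrite /=; slia.
case: k => [[r args]|]; case: k' => [[r' args']|]; last 3 first.
- by move=> ks _ h [_ es]; subst s; case: (no _ _ _ ks h).
- by move=> _ ks [_ es] h; subst s; case: (no _ _ _ ks h).
- by move=> _ _ /= [-> _] [-> _].
move=> /mem_keys_some[tup [-> re sz H a]] /mem_keys_some[tup' [-> re' sz' H' a']].
move=> /(produces_state _ _ sz H)[h Hk et] /(produces_state _ _ sz' H')[h' Hk' et'].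
have [? ?] := subst_uniq (root_canonical re Hk) (root_canonical re' Hk') h h'.
subst r' ps'; split=> //; congr (Some (_, _)).
apply: (@eq_from_nth _ 0); rewrite !size_map ?sz // => k hk.
rewrite !(nth_map (0, [::])) ?sz ?sz' //.
have e2 : (nth (0, [::]) tup k).2 = (nth (0, [::]) tup' k).2.
  by rewrite -!(nth_map _ [::]) ?sz ?sz' // -et -et'.
have := H k hk; have := H' k hk; rewrite (surjective_pairing (nth _ tup k)) e2.
rewrite (surjective_pairing (nth _ tup' k)) /= => h1 h2; exact: states_inj h2 h1.
Qed.

(** Unambiguity is required for positions in the right-hand side, so no term may be listed twice. *)
Lemma uniq_keys : uniq keys.
Proof.
have : uniq (map fst (candidates S P Ts e)).
  rewrite /= map_flatten -!map_comp; apply/andP; split.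
    by apply/negP => /flatten_mapP[r _ /mapP[c /mem_root_candidates[tup [-> _ _]]]].
  have ur : uniq (root_list S e).
    have n d : pd d \notin undup S by apply/negP => /mem_S_simple/pd_not_simple.
    have n1 := n true; have n2 := n false; rewrite /= in n1 n2.
    by rewrite /root_list; case: (e); rewrite /= ?in_cons ?negb_or ?n1 ?n2 ?undup_uniq.
  have -> : [seq (map fst \o root_candidates P Ts) r | r <- root_list S e] =
      [seq [seq Some (r, args) | args <- cart (map (map fst) (map (states Ts) (arg_eps r)))]
        | r <- root_list S e].
    by apply/eq_map => r; rewrite /= -map_cart -!map_comp.
  apply: allpairs_uniq_dep => // [r _|].
    apply: uniq_cart; elim: (arg_eps r) => //= e' es ->.
    by rewrite states_fst iota_uniq.
  by move=> [r a] [r' a'] _ _ /= [-> ->].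
apply: subseq_uniq; apply: map_subseq; exact: filter_subseq.
Qed.

End Equation.
End Specification.

(** * The equations form a combinatorial specification *)

Section SpecificationCorrect.
Variables B S : seq permutation.
Hypothesis HS : forall s : permutation, s \in S <-> simple_perm s /\ Av B s.

Let P := patterns B.
Let Ts := safe_types B P.
Let C := Av B.
Let sp := spec_of B S.
Let X := spec_set C sp.

Lemma spec_set0 : X 0 = C.
Proof.
apply/seteqP; split=> s; first by case.
by move=> Cs; split=> //; apply: Av_closure.
Qed.

Lemma equation_form i : i < size sp -> exists e (acc : pred (seq permutation)),
  [/\ forall T, acc T -> ~~ has (fun b => b \in T) B,
      rhs (eq_nth sp i) = map to_term [seq c.1 | c <- candidates S P Ts e & acc c.2] &
      forall s, X i s <-> closure_eps C e s /\ acc (type_of P s)].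
Proof.
move=> /index_cases[->|[e [T hT]]].
  exists EpsBlank, (fun T => ~~ has (fun b => b \in T) B); split=> //.
    by rewrite -map_comp.
  move=> s; rewrite spec_set0; split; last by case=> _ /avoids_type.
  by move=> Cs; split; [apply: Av_closure|apply/avoids_type].
have [_ TT eT] := mem_states S hT.
exists e, (fun T' => T' == T); split.
- by move=> _ /eqP->; move: TT; rewrite mem_filter => /andP[].
- by rewrite eT /= -map_comp.
by move=> s; apply: (iff_trans (state_set S s hT)); split=> -[ce /eqP h]; split=> //; apply/eqP.
Qed.

Lemma spec_set_sub i : i < size sp -> (X i `<=` C)%classic.
Proof.
move=> /equation_form[e [acc [safe _ HX]]] s /HX[_ /safe h]; exact/avoids_type.
Qed.

Lemma comb_specification_spec_of : comb_specification C B S sp.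
Proof.
split.
- by split=> //; apply: spec_set0.
- move=> i j hi; have [e [acc [safe -> _]]] := equation_form hi.
  rewrite size_map => hj; rewrite (nth_map None) //.
  have := mem_nth None hj; case: nth => // -[r args] /mem_keys_some[tup [-> re sz H _]] /=.
  split; rewrite ?size_map //.
    by case/root_list_cases: re => [[]|[]|]; [constructor 1|constructor 2|rewrite mem_undup; constructor 3].
  move=> a /mapP[[a' T] /(nthP (0, [::]))[k]]; rewrite sz => hk ek ->.
  by have := H k hk; rewrite ek => /(mem_states S)[/andP[]].
- move=> i s hi; have [e [acc [safe er HX]]] := equation_form hi.
  have [K1 K2] := keysP HS e safe s; rewrite er size_map; split.
    move=> /HX/K1[k [ps [/(nthP None)[j hj <-] pr]]]; exists j, ps.
    by rewrite (nth_map None).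
  move=> [j [ps [hj pr]]]; apply/HX/K2; rewrite (nth_map None) // in pr.
  by exists (nth None [seq c.1 | c <- candidates S P Ts e & acc c.2] j), ps; rewrite mem_nth.
- move=> i s j j' ps ps' hi; have [e [acc [safe -> _]]] := equation_form hi.
  rewrite size_map => hj hj'; rewrite !(nth_map None) // => pr pr'.
  have [ej ->] := keys_unambiguous HS (mem_nth None hj) (mem_nth None hj') pr pr'.
  by split=> //; apply/eqP; rewrite -(nth_uniq None hj hj') ?ej ?eqxx //; apply: uniq_keys.
move=> i p /index_cases[->|[e [T hT]]].
  by rewrite /= cats0 => pB; exists p => //; apply: pattern_refl.
have [_ TT eT] := mem_states S hT; rewrite eT /= mem_cat => h; apply/patternsP.
case/orP: h; first by rewrite mem_filter => /andP[].
by move: TT; rewrite mem_filter mem_subs => /andP[_ /mem_subseq]; apply.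
Qed.

End SpecificationCorrect.

(** * Generating functions *)

Lemma mem_perms_of_size n (p : permutation) : (p \in perms_of_size n) = (size p == n).
Proof.
rewrite mem_pmap_sub mem_permutations -[val p]/(word p).
have /andP[_ pe] := word_perm p.
apply/idP/eqP => [/perm_size|<- //]; by rewrite size_iota.
Qed.

Lemma uniq_perms_of_size n : uniq (perms_of_size n).
Proof. by apply: pmap_sub_uniq; apply: permutations_uniq. Qed.

Section GeneratingFunctions.
Variables (C : set permutation) (B S : seq permutation) (sp : specification).
Hypothesis comb : comb_specification C B S sp.

Let X := spec_set C sp.

Definition sized (Y : set permutation) (n : nat) : seq permutation :=
  [seq p <- perms_of_size n | `[< Y p >]].

Lemma mem_sized (Y : set permutation) n p : reflect (Y p /\ size p = n) (p \in sized Y n).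
Proof.
by rewrite mem_filter mem_perms_of_size; apply: (iffP andP) => -[/asboolP ? /eqP].
Qed.

Lemma gen_funE (Y : set permutation) n : gen_fun Y n = Posz (size (sized Y n)).
Proof. by rewrite /gen_fun size_filter. Qed.

Lemma Posz_sumn (s : seq nat) : Posz (sumn s) = (\sum_(i <- s) Posz i)%R.
Proof. by elim: s => [|i s IH] /=; rewrite ?big_nil ?big_cons // PoszD IH. Qed.

(** Splitting on the size of the first component mirrors the Cauchy product [fps_mul], which makes
    the counting in [size_tuples] immediate. *)
Fixpoint tuples (F : nat -> set permutation) (args : seq nat) (n : nat) :
    seq (seq permutation) :=
  if args is a :: args' then
    flatten [seq [seq p :: ps | p <- sized (F a) k, ps <- tuples F args' (n - k)]
      | k <- index_iota 0 n.+1]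
  else if n == 0 then [:: [::]] else [::].

Lemma tuples_cons F a args n :
  tuples F (a :: args) n =
  flatten [seq [seq p :: ps | p <- sized (F a) k, ps <- tuples F args (n - k)]
    | k <- index_iota 0 n.+1].
Proof. by []. Qed.

Lemma mem_tuples F args n ps :
  reflect [/\ size ps = size args,
      forall k, k < size args -> F (nth 0 args k) (nth p1 ps k) &
      sumn [seq size (word p) | p <- ps] = n]
    (ps \in tuples F args n).
Proof.
elim: args n ps => [|a args IH] n ps.
  have [->|n0] := eqVneq n 0; [rewrite /= mem_seq1|rewrite /= (negbTE n0) in_nil].
    by apply: (iffP eqP) => [->|[]] //; case: ps.
  by apply: (iffP idP) => // -[]; case: ps => // _ _ /= e; rewrite -e in n0.
rewrite tuples_cons; apply: (iffP flatten_mapP) => [[k]|[]].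
  rewrite mem_index_iota ltnS => /= kn /allpairsPdep[p [qs [/mem_sized[Fp sp'] /IH[sz H sm] ->]]].
  by split=> [|[|j] hj|] //=; [rewrite sz|apply: H|rewrite sm sp' subnKC].
case: ps => // p ps /= [sz] H <-; exists (size p); first by rewrite mem_index_iota ltnS leq_addr.
apply/allpairsPdep; exists p, ps; split=> //; first by apply/mem_sized; split=> //; apply: (H 0).
by apply/IH; split=> // [k hk|]; [apply: (H k.+1)|rewrite addKn].
Qed.

Lemma uniq_tuples F args n : uniq (tuples F args n).
Proof.
elim: args n => [|a args IH] n; first by rewrite /=; case: eqP.
have U k : uniq [seq p :: ps | p <- sized (F a) k, ps <- tuples F args (n - k)].
  apply: allpairs_uniq => //; first exact/filter_uniq/uniq_perms_of_size.
  by move=> [p ps] [q qs] _ _ /= [-> ->].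
rewrite tuples_cons; have := iota_uniq 0 (n.+1 - 0); rewrite -/(index_iota 0 n.+1).
elim: (index_iota 0 n.+1) => //= k ks IHk /andP[kn uk].
rewrite cat_uniq U IHk //=; apply/andP; split=> //; apply/hasPn => qs /flatten_mapP[k' k'ks].
move=> /allpairsPdep[p [ps [/mem_sized[_ sp1] _ ->]]].
apply/negP => /allpairsPdep[q [rs [/mem_sized[_ sq] _ [epq _]]]].
by move: kn; rewrite -sq -epq sp1 k'ks.
Qed.

Lemma size_tuples F args n :
  Posz (size (tuples F args n)) =
    foldr (fun i f => fps_mul (gen_fun (F i)) f) fps_one args n.
Proof.
elim: args n => [|a args IH] n; first by rewrite /= /fps_one; case: eqP.
rewrite tuples_cons size_flatten /shape -map_comp Posz_sumn big_map.
rewrite big_mkord /fps_mul; apply: eq_bigr => k _ /=.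
by rewrite size_allpairs PoszM IH gen_funE.
Qed.

Definition term_tuples (t : term) (n : nat) : seq (seq permutation) :=
  match t with
  | Atom => if n == 1 then [:: [::]] else [::]
  | Inflate _ args => tuples X args n
  end.

Lemma size_term_tuples t n :
  Posz (size (term_tuples t n)) =
    monomial_eval (fun i => gen_fun (X i)) (gf_monomial t) n.
Proof.
case: t => [|r args]; rewrite /monomial_eval /fps_mul /=.
  case: n => [|n]; rewrite big_ord_recl /= mul0r add0r ?big_ord0 //.
  rewrite big_ord_recl /= mul1r subSS subn0 /fps_one.
  rewrite big1 => [|i _]; last by rewrite mul0r.
  by case: n.
rewrite big_ord_recl /= mul1r subn0 big1 => [|i _]; last by rewrite mul0r.
by rewrite addr0 size_tuples.
Qed.

Lemma wf_equation i j : i < size sp -> j < size (rhs (eq_nth sp i)) ->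
  wf_term S (size sp) (nth Atom (rhs (eq_nth sp i)) j).
Proof. by case: comb => _ h _ _ _; apply: h. Qed.

Lemma mem_term_tuples t n ps : wf_term S (size sp) t ->
  ps \in term_tuples t n <-> exists s, produces X t ps s /\ size (word s) = n.
Proof.
case: t => [_|r args [_ sz _]] /=.
  have [->|n1] := eqVneq n 1.
    rewrite mem_seq1; split=> [/eqP->|[s [[-> _] _]] //]; by exists p1.
  by split=> // -[s [[_ ->] e]]; rewrite -e in n1.
split=> [/mem_tuples[szp H sm]|[s [[szp H h] sn]]].
  have h : is_subst r ps (infl r ps) by apply: inflP; rewrite szp.
  by exists (infl r ps); split=> //; rewrite (size_subst h).
by apply/mem_tuples; split=> //; rewrite -(size_subst h).
Qed.

Definition assemble (t : term) (ps : seq permutation) : permutation :=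
  match t with Atom => p1 | Inflate r _ => infl r ps end.

Lemma produces_assemble t ps s : produces X t ps s -> s = assemble t ps.
Proof. by case: t => [[]|r args [_ _ /is_substP]]. Qed.

(** The map [out] is a bijection from pairs of a term index and a tuple, of resulting size [n], onto
    the permutations of size [n] in [X i]: injective by unambiguity, onto by the equation itself. *)
Lemma gf_system_satisfied :
  satisfies (fun i => gen_fun (X i)) (gf_system sp).
Proof.
move=> i; rewrite size_map => hi; apply/funext => n.
rewrite (nth_map (Equation (Restriction EpsBlank [::] [::]) [::])) // -/(eq_nth sp i).
rewrite big_map; under eq_bigr => t _ do rewrite -size_term_tuples.
rewrite (big_nth Atom) gen_funE /index_iota subn0.
set r := rhs (eq_nth sp i).
pose D := [seq (j, ps) | j <- iota 0 (size r), ps <- term_tuples (nth Atom r j) n].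
pose out (u : nat * seq permutation) := assemble (nth Atom r u.1) u.2.
have -> : (\sum_(j <- iota 0 (size r)) Posz (size (term_tuples (nth Atom r j) n)))%R
    = Posz (size (map out D)).
  rewrite size_map size_flatten /shape -map_comp Posz_sumn big_map.
  by apply: eq_bigr => j _; rewrite /= size_map.
have DP u : u \in D -> u.1 < size r /\
    exists2 s, produces X (nth Atom r u.1) u.2 s & size (word s) = n.
  move=> /allpairsPdep[j [ps [hj hps ->]]] /=; rewrite mem_iota add0n /= in hj; split=> //.
  by move: hps => /(mem_term_tuples _ _ (wf_equation hi hj))[s [pr sn]]; exists s.
have [_ _ eqX unamb _] := comb.
congr Posz; apply/perm_size/uniq_perm.
- exact/filter_uniq/uniq_perms_of_size.
- rewrite map_inj_in_uniq; last first.
    move=> [j ps] [j' ps'] /DP[/= hj [s pr _]] /DP[/= hj' [s' pr' _]] e.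
    have es : s = s' by rewrite (produces_assemble pr) (produces_assemble pr').
    by subst s'; have [-> ->] := unamb i s j j' ps ps' hi hj hj' pr pr'.
  apply: allpairs_uniq_dep => [|j|].
  - exact: iota_uniq.
  - by case: nth => [|r' args]; [rewrite /=; case: eqP|move=> _; apply: uniq_tuples].
  by move=> [a b] [a' b'] _ _ /= [-> ->].
move=> s; apply/mem_sized/mapP => [[/(eqX _ _ hi)[j [ps [hj pr]]] sn]|[[j ps] /DP[/= hj [s' pr sn]] e]].
  exists (j, ps); last exact: produces_assemble pr.
  apply/allpairsPdep; exists j, ps; split=> //; first by rewrite mem_iota.
  by apply/(mem_term_tuples _ _ (wf_equation hi hj)); exists s.
have -> : s = s' by rewrite e /out (produces_assemble pr).
by split=> //; apply/(eqX _ _ hi); exists j, ps.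
Qed.

End GeneratingFunctions.

Lemma gf_system_positive sp : positive_system (gf_system sp).
Proof.
move=> i j; rewrite size_map => hi.
rewrite (nth_map (Equation (Restriction EpsBlank [::] [::]) [::])) // size_map => hj.
by rewrite (nth_map Atom) //; case: nth.
Qed.

(** * Boltzmann sampler *)

Section GfValue.
Local Open Scope ring_scope.
Local Open Scope classical_set_scope.
Variables (R : realType) (x : R).
Hypothesis x0 : 0 < x.

Lemma gf_value_sub (A C : set permutation) : A `<=` C ->
  (gf_value A x <= gf_value C x)%E.
Proof.
move=> AC; apply: le_ereal_sup => _ [F [finF FA] <-]; exists F => //.
by split=> //; apply: subset_trans AC.
Qed.

Lemma gf_value_gt0 (A : set permutation) s : A s -> (gf_value A x < +oo)%E ->
  0 < fine (gf_value A x).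
Proof.
move=> As fin; apply: fine_gt0; rewrite fin andbT.
apply: (@lt_le_trans _ _ (x ^+ size s)%:E); first by rewrite lte_fin exprn_gt0.
rewrite -(@esum_set1 _ _ s (fun s : permutation => (x ^+ size s)%:E)).
  by apply: gf_value_sub => _ ->.
by rewrite lee_fin exprn_ge0 // ltW.
Qed.

End GfValue.

Section Sampler.
Local Open Scope ring_scope.
Local Open Scope classical_set_scope.
Variables (C : set permutation) (B S : seq permutation) (sp : specification).
Hypothesis comb : comb_specification C B S sp.

Hypothesis S_root : forall r : permutation, r \in S -> (1 < size r)%N.

Let X := spec_set C sp.
Hypothesis XC : forall i, (i < size sp)%N -> X i `<=` C.
Variables (R : realType) (x : R).
Hypotheses (x0 : 0 < x) (fin : (gf_value C x < +oo)%E).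

Let v a := fine (gf_value (X a) x).

Let inner n s t : R :=
  match t with
  | Atom => (s == p1)%:R
  | Inflate r args =>
      \sum_(ps \in [set ps | is_subst r ps s])
        \prod_(k < size args) sampler X sp x n (nth 0%N args k) (nth p1 ps k)
  end.

Lemma samplerS n i s : sampler X sp x n.+1 i s =
  \sum_(t <- rhs (eq_nth sp i)) term_value X x t / v i * inner n s t.
Proof. by []. Qed.

Lemma prod_eq0 (m : nat) (F : nat -> R) k : (k < m)%N -> F k = 0 -> \prod_(j < m) F j = 0.
Proof. by move=> km Fk; rewrite (bigD1 (Ordinal km)) //= Fk mul0r. Qed.

(** The sampler sums over all [ps] with [r[ps] = s]; a tuple that the term does not produce
    contributes 0, through a component outside its set. *)
Lemma not_produces_arg (t : term) ps s r args : t = Inflate r args ->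
  wf_term S (size sp) t -> is_subst r ps s -> ~ produces X t ps s ->
  exists2 k, (k < size args)%N & ~ X (nth 0%N args k) (nth p1 ps k).
Proof.
move=> -> [_ sz _] h np; apply: contrapT => H; apply: np; split=> //.
  by rewrite sz; apply: size_subst_args h.
by move=> k hk; apply: contrapT => nX; apply: H; exists k.
Qed.

Lemma sampler_inner_eq0 n s t : wf_term S (size sp) t ->
  (forall i s, (i < size sp)%N -> ~ X i s -> sampler X sp x n i s = 0) ->
  (forall ps, ~ produces X t ps s) -> inner n s t = 0.
Proof.
case: t => [_|r args wf] IH np /=.
  by case: eqVneq => // e; case: (np [::]).
apply: fsbig1 => ps h; have [k hk nX] := not_produces_arg erefl wf h (np ps).
apply: (prod_eq0 (F := fun k => sampler X sp x n (nth 0%N args k) (nth p1 ps k)) hk).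
by apply: IH => //; case: wf => _ _; apply; apply: mem_nth.
Qed.

Lemma sampler_eq0 n i s : (i < size sp)%N -> ~ X i s -> sampler X sp x n i s = 0.
Proof.
elim: n i s => // n IH i s hi nX; rewrite samplerS (big_nth Atom) big_mkord big1 // => -[j hj] _ /=.
rewrite sampler_inner_eq0 ?mulr0 //; first exact: (wf_equation comb).
have [_ _ eqX _ _] := comb.
by move=> ps pr; apply/nX/eqX => //; exists j, ps.
Qed.

Lemma spec_value_gt0 i s : (i < size sp)%N -> X i s -> 0 < v i.
Proof.
move=> hi Xs; apply: (gf_value_gt0 x0 Xs); apply: le_lt_trans fin.
exact/gf_value_sub/XC.
Qed.

(** By unambiguity a single term and a single tuple contribute. The weight of the term is the
    product of the values of its factors divided by [v i], and these values cancel against the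
    denominators of the recursive calls. *)
Lemma sampler_value n i s : (i < size sp)%N -> X i s -> (size s <= n)%N ->
  sampler X sp x n i s = x ^+ size s / v i.
Proof.
elim: n i s => [|n IH] i s hi Xs sn; first by have := size_word_gt0 s; slia.
have [_ _ eqX unamb _] := comb.
have [j [ps [hj pr]]] := (eqX i s hi).1 Xs.
rewrite samplerS (big_nth Atom) big_mkord (bigD1 (Ordinal hj)) //= big1 ?addr0; last first.
  move=> j' nj; rewrite sampler_inner_eq0 ?mulr0 //.
  - exact: (wf_equation comb).
  - by move=> *; apply: sampler_eq0.
  move=> ps' pr'; have [ej _] := unamb i s j j' ps ps' hi hj (ltn_ord j') pr pr'.
  by case/eqP: nj; apply: val_inj.
have := wf_equation comb hi hj; case E : (nth Atom _ j) pr => [|r args] pr wf.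
  by case: pr => _ -> /=; rewrite expr1 mulr1.
case: (pr) => szp Xp h /=; case: (wf) => rt sz am.
have r2 : (1 < size r)%N by case: rt => [->|->|/S_root].
rewrite -(@fsbig_widen _ _ _ _ [set ps]); last 2 first.
- by move=> _ ->.
- move=> ps' [h' ne] /=; have np : ~ produces X (Inflate r args) ps' s.
    move=> pr'; apply: ne; rewrite -E in pr pr'.
    by have [_ ->] := unamb i s j j ps ps' hi hj hj pr pr'.
  have [k hk nX] := not_produces_arg erefl wf h' np.
  apply: (prod_eq0 (F := fun k => sampler X sp x n (nth 0%N args k) (nth p1 ps' k)) hk).
  by apply: sampler_eq0 => //; apply/am/mem_nth.
rewrite fsbig_set1 (big_nth 0%N) big_mkord mulrAC -big_split /=.
congr (_ / _); rewrite (size_subst h) sumnE big_map (big_nth p1) big_mkord szp expr_sum.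
apply: eq_bigr => k _; have ha : nth 0%N args k \in args by apply: mem_nth.
rewrite IH //; last 3 first.
- exact: am.
- exact: Xp.
(* A component is strictly smaller than [s], so depth [n] suffices for it. *)
- rewrite -ltnS; apply: leq_trans sn; apply: (size_subst_arg h r2).
  by apply: mem_nth; rewrite szp.
(* Cancellation needs a nonzero value, and the component at hand is an element witnessing
   positivity. *)
by rewrite mulrC divfK // gt_eqF // (spec_value_gt0 (am _ ha) (Xp _ (ltn_ord k))).
Qed.

Lemma boltzmann_sampler_spec : (0 < size sp)%N -> X 0%N = C -> boltzmann_sampler C sp x.
Proof.
move=> s0 X0; split=> s Cs; rewrite -[spec_set C sp]/X.
  apply: (@cvg_near_cst _ _ _ _ _); exists (size s) => // n /= sn.
  by rewrite sampler_value ?X0 // /v X0.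
apply: cvg_near_cst; apply: nearW => n.
by rewrite sampler_eq0 ?X0.
Qed.

End Sampler.

(** * WHILE programs *)

(** As a class, the encoding of a composite type is found from the type alone by the tactic
    [comp]. *)
Class Enc (A : Type) := enc : A -> tree.
#[local] Instance Enc_nat : Enc nat := enc_nat.
#[local] Instance Enc_bool : Enc bool := fun b => if b then Defs.Cons Defs.Nil Defs.Nil else Defs.Nil.
#[local] Instance Enc_prod A B (EA : Enc A) (EB : Enc B) : Enc (A * B) :=
  fun u => Defs.Cons (EA u.1) (EB u.2).
#[local] Instance Enc_seq A (EA : Enc A) : Enc (seq A) := enc_seq EA.
#[local] Instance Enc_perm : Enc permutation := enc_perm.
#[local] Instance Enc_eps : Enc epsilon := enc_eps.
(** Same tree as the term, and for [Some] the same tree as the pair: both [Some] and [to_term] cost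
    no computation. *)
#[local] Instance Enc_key : Enc (option (permutation * seq nat)) :=
  fun k => enc_term (to_term k).
#[local] Instance Enc_term : Enc term := enc_term.
#[local] Instance Enc_restriction : Enc restriction := enc_restriction.
#[local] Instance Enc_equation : Enc equation := enc_equation.

Lemma enc_nat_inj : injective enc_nat.
Proof. by elim=> [|m IH] [|n] //= [/IH->]. Qed.

Lemma enc_seq_inj A (EA : Enc A) : injective EA -> injective (enc_seq EA).
Proof. by move=> injA; elim=> [|x s IH] [|y t] //= [/injA-> /IH->]. Qed.

Lemma enc_perm_inj : injective enc_perm.
Proof. by move=> p q /(enc_seq_inj enc_nat_inj)/word_inj. Qed.

Definition computable A B {EA : Enc A} {EB : Enc B} (f : A -> B) : Prop :=
  exists p, forall a, run p (enc a) (enc (f a)).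

Lemma comp_id {E : Type} {EE : Enc E} : computable (fun x : E => x).
Proof. by exists PId => a; constructor. Qed.

Lemma comp_const {E : Type} {EE : Enc E} B {EB : Enc B} (b : B) : computable (fun _ : E => b).
Proof.
have [p Hp] : exists p, forall x, run p x (enc b).
  elim: (enc b) => [|t [p Hp] u [q Hq]]; first by exists PNil; constructor.
  by exists (PCons p q) => x; constructor.
by exists p.
Qed.

Lemma comp_comp {E : Type} {EE : Enc E} A B {EA : Enc A} {EB : Enc B} (g : A -> B) (f : E -> A) :
  computable g -> computable f -> computable (fun x => g (f x)).
Proof. by move=> [p Hp] [q Hq]; exists (PSeq q p) => a; apply: run_seq (Hq a) (Hp _). Qed.

Lemma comp_pair {E : Type} {EE : Enc E} A B {EA : Enc A} {EB : Enc B} (f : E -> A) (g : E -> B) :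
  computable f -> computable g -> computable (fun x => (f x, g x)).
Proof. by move=> [p Hp] [q Hq]; exists (PCons p q) => a; constructor. Qed.

Lemma comp_fst {E : Type} {EE : Enc E} A B {EA : Enc A} {EB : Enc B} (f : E -> A * B) :
  computable f -> computable (fun x => (f x).1).
Proof.
by move=> [p Hp]; exists (PSeq p PHead) => a; apply: run_seq (Hp a) _; constructor.
Qed.

Lemma comp_snd {E : Type} {EE : Enc E} A B {EA : Enc A} {EB : Enc B} (f : E -> A * B) :
  computable f -> computable (fun x => (f x).2).
Proof.
by move=> [p Hp]; exists (PSeq p PTail) => a; apply: run_seq (Hp a) _; constructor.
Qed.

Lemma comp_cons {E : Type} {EE : Enc E} A {EA : Enc A} (f : E -> A) (g : E -> seq A) :
  computable f -> computable g -> computable (fun x => f x :: g x).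
Proof. by move=> [p Hp] [q Hq]; exists (PCons p q) => a; constructor. Qed.

Lemma comp_succ {E : Type} {EE : Enc E} (f : E -> nat) : computable f -> computable (fun x => (f x).+1).
Proof. by move=> [p Hp]; exists (PCons PNil p) => a; constructor; [constructor|]. Qed.

Lemma comp_pred {E : Type} {EE : Enc E} (f : E -> nat) : computable f -> computable (fun x => (f x).-1).
Proof.
move=> [p Hp]; exists (PSeq p PTail) => a; apply: run_seq (Hp a) _.
by case: (f a) => [|n]; constructor.
Qed.

Lemma comp_if {E : Type} {EE : Enc E} B {EB : Enc B} (c : E -> bool) (f g : E -> B) :
  computable c -> computable f -> computable g ->
  computable (fun x => if c x then f x else g x).
Proof.
move=> [r Hr] [p Hp] [q Hq]; exists (PIf r p q) => a.
have := Hr a; case: (c a) => h; first exact: run_if_true h (Hp a).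
exact: run_if_false h (Hq a).
Qed.

Lemma comp_seq_case {E : Type} {EE : Enc E} A B {EA : Enc A} {EB : Enc B} (l : E -> seq A) (f : E -> B)
    (g : E -> A -> seq A -> B) :
  computable l -> computable f ->
  computable (fun x : E * A * seq A => g x.1.1 x.1.2 x.2) ->
  computable (fun x => if l x is a :: s then g x a s else f x).
Proof.
move=> [r Hr] [p Hp] [q Hq].
exists (PIf r (PSeq (PCons (PCons PId (PSeq r PHead)) (PSeq r PTail)) q) p) => e.
have := Hr e; case: (l e) => [|a s] h; first exact: run_if_false h (Hp e).
have h2 := h; apply: run_if_true h2 _; apply: run_seq (Hq (e, a, s)).
apply: run_cons; last by apply: (run_seq h); apply: run_tail.
by apply: run_cons; [exact: run_id|apply: (run_seq h); apply: run_head].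
Qed.

(** The three constraints are encoded as 0, 1, 2: the outer test detects 0, and the tail separates 1
    from 2. *)
Lemma comp_eps_case {E : Type} {EE : Enc E} B {EB : Enc B} (e : E -> epsilon) (f g h : E -> B) :
  computable e -> computable f -> computable g -> computable h ->
  computable (fun x =>
    match e x with EpsBlank => f x | EpsPlus => g x | EpsMinus => h x end).
Proof.
move=> [r Hr] [p Hp] [q Hq] [s Hs].
exists (PIf r (PIf (PSeq r PTail) s q) p) => a.
have := Hr a; case: (e a) => H.
- exact: run_if_false H (Hp a).
- have H2 := H; apply: run_if_true H2 _; apply: run_if_false _ (Hq a).
  by apply: run_seq H _; constructor.
have H2 := H; apply: run_if_true H2 _; apply: run_if_true _ (Hs a).
by apply: run_seq H _; constructor.
Qed.

Lemma comp_eq {E : Type} {EE : Enc E} (A : eqType) {EA : Enc A} (f g : E -> A) : injective EA ->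
  computable f -> computable g -> computable (fun x => f x == g x).
Proof.
move=> injA [p Hp] [q Hq]; exists (PEq p q) => a.
have := Hp a; have := Hq a; case: eqVneq => [->|ne] hq hp; first exact: run_eq_true hp hq.
by apply: run_eq_false hp hq _ => /injA /eqP; apply/negP.
Qed.

(** During the loop the store holds the environment, the unread part of the list and the
    accumulator; the loop stops when the list is empty, that is, encoded by [Nil]. *)
Lemma comp_foldl {E : Type} {EE : Enc E} A T {EA : Enc A} {ET : Enc T} (l : E -> seq A) (z : E -> T)
    (f : E -> T -> A -> T) :
  computable l -> computable z ->
  computable (fun x : E * T * A => f x.1.1 x.1.2 x.2) ->
  computable (fun x => foldl (f x) (z x) (l x)).
Proof.
move=> [pl Hl] [pz Hz] [pf Hf].
pose lst := PSeq PTail PHead; pose acc := PSeq PTail PTail.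
pose body := PCons PHead (PCons (PSeq lst PTail)
  (PSeq (PCons (PCons PHead acc) (PSeq lst PHead)) pf)).
exists (PSeq (PCons PId (PCons pl pz)) (PSeq (PWhile lst body) acc)) => e.
apply: run_seq; first by apply: run_cons; [constructor|apply: run_cons; [apply: Hl|apply: Hz]].
have Hlst u v w : run lst (Defs.Cons u (Defs.Cons v w)) v by apply: run_seq; constructor.
have Hacc u v w : run acc (Defs.Cons u (Defs.Cons v w)) w by apply: run_seq; constructor.
suff H : forall (s : seq A) (t : T), run (PWhile lst body)
    (Defs.Cons (EE e) (Defs.Cons (enc_seq EA s) (ET t)))
    (Defs.Cons (EE e) (Defs.Cons Defs.Nil (ET (foldl (f e) t s)))).
  exact: run_seq (H (l e) (z e)) (Hacc _ _ _).
elim=> [|a s IH] t; first by apply: run_while_stop; apply: Hlst.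
apply: run_while_step (IH (f e t a)); first exact: Hlst.
apply: run_cons; first by constructor.
apply: run_cons; first by apply: run_seq (Hlst _ _ _) _; constructor.
apply: run_seq (Hf (e, t, a)); apply: run_cons; last first.
  by apply: run_seq (Hlst _ _ _) _; apply: run_head.
by apply: run_cons; [exact: run_head|exact: Hacc].
Qed.

Lemma comp_ext A B {EA : Enc A} {EB : Enc B} (f g : A -> B) :
  f =1 g -> computable g -> computable f.
Proof. by move=> fg [p Hp]; exists p => a; rewrite fg. Qed.

Lemma comp_rev {E : Type} {EE : Enc E} A {EA : Enc A} (l : E -> seq A) :
  computable l -> computable (fun x => rev (l x)).
Proof.
move=> Hl; apply: (@comp_ext _ _ _ _ _ (fun x => foldl (fun t a => a :: t) [::] (l x))).
  have H s t : catrev s t = foldl (fun (t : seq A) a => a :: t) t s by elim: s t => //=.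
  by move=> x; apply: H.
apply: (comp_foldl (f := fun _ t a => a :: t)) => //; first exact: comp_const.
by apply: comp_cons; [apply: comp_snd; apply: comp_id|apply: comp_snd; apply: comp_fst; apply: comp_id].
Qed.

Lemma comp_foldr {E : Type} {EE : Enc E} A T {EA : Enc A} {ET : Enc T} (l : E -> seq A) (z : E -> T)
    (f : E -> A -> T -> T) :
  computable l -> computable z ->
  computable (fun x : E * A * T => f x.1.1 x.1.2 x.2) ->
  computable (fun x => foldr (f x) (z x) (l x)).
Proof.
move=> Hl Hz Hf.
apply: (@comp_ext _ _ _ _ _ (fun x => foldl (fun t a => f x a t) (z x) (rev (l x)))).
  by move=> x; rewrite -[l x in LHS]revK -foldl_rev revK.
apply: (comp_foldl (f := fun x t a => f x a t)) => //; first exact: comp_rev.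
apply: (comp_comp (g := fun x : E * A * T => f x.1.1 x.1.2 x.2)
  (f := fun x : E * T * A => (x.1.1, x.2, x.1.2))) => //.
apply: comp_pair; first apply: comp_pair.
- by apply/comp_fst/comp_fst/comp_id.
- by apply/comp_snd/comp_id.
by apply/comp_snd/comp_fst/comp_id.
Qed.

(** Applications of a function whose computability is a hypothesis, stated for the function of the
    pair of its arguments when there are two. *)
Ltac comp_hyp :=
  match goal with
  | H : computable ?g |- computable ?g => exact H
  | |- computable (fun x => ?h (@?a x) (@?b x)) =>
      match goal with
      | H : computable (fun y => h y.1 y.2) |- _ =>
          simple refine (comp_comp (g := fun y => h y.1 y.2) (f := fun x => (a x, b x)) H _)
      end
  | |- computable (fun x => ?h (@?a x)) =>
      match goal with
      | H : computable h |- _ => simple refine (comp_comp (g := h) (f := a) H _)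
      end
  end.
(** Redefined each time new operations are shown computable, so that [comp_step] handles them
    too. *)
Ltac comp_more := fail.
Ltac comp_step :=
  cbv beta;
  lazymatch goal with
  | |- computable (fun x => x) => exact comp_id
  | |- computable (fun _ => ?c) => exact (comp_const c)
  | |- computable (fun x => (@?f x).1) => simple refine (comp_fst (f := f) _)
  | |- computable (fun x => (@?f x).2) => simple refine (comp_snd (f := f) _)
  | |- computable (fun x => (@?f x, @?g x)) => simple refine (comp_pair (f := f) (g := g) _ _)
  | |- computable (fun x => @?f x :: @?g x) => simple refine (comp_cons (f := f) (g := g) _ _)
  | |- computable (fun x => (@?f x).+1) => simple refine (comp_succ (f := f) _)
  | |- computable (fun x => (@?f x).-1) => simple refine (comp_pred (f := f) _)
  | |- computable (fun _ => if _ then _ else _) => simple refine (comp_if _ _ _)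
  | |- computable fst => exact (comp_fst comp_id)
  | |- computable snd => exact (comp_snd comp_id)
  | |- _ => first [comp_more | comp_hyp]
  end.
Ltac comp := repeat comp_step.

(** A number has the same encoding as a list of that many units encoded by [Nil], so iteration is a
    fold. *)
Lemma comp_iter {E : Type} {EE : Enc E} T {ET : Enc T} (n : E -> nat) (z : E -> T) (f : E -> T -> T) :
  computable n -> computable z -> computable (fun x : E * T => f x.1 x.2) ->
  computable (fun x => iter (n x) (f x) (z x)).
Proof.
move=> Hn Hz Hf; pose EU : Enc unit := fun _ => Defs.Nil.
have Hl : computable (fun x => nseq (n x) tt).
  case: Hn => p Hp; exists p => a; have -> // : enc (nseq (n a) tt) = enc (n a).
  by elim: (n a) => //= k; rewrite /enc /Enc_seq /= => ->.
apply: (@comp_ext _ _ _ _ _ (fun x => foldl (fun t _ => f x t) (z x) (nseq (n x) tt))).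
  move=> x; elim: (n x) (z x) => //= k IH t; rewrite -IH.
  by elim: k {IH} => //= k ->.
apply: (comp_foldl (f := fun x t _ => f x t)) => //.
by comp.
Qed.

Lemma comp_andb {E : Type} {EE : Enc E} (a b : E -> bool) : computable a -> computable b ->
  computable (fun x => a x && b x).
Proof. by move=> Ha Hb; apply: comp_if => //; apply: comp_const. Qed.

Lemma comp_orb {E : Type} {EE : Enc E} (a b : E -> bool) : computable a -> computable b ->
  computable (fun x => a x || b x).
Proof. by move=> Ha Hb; apply: comp_if => //; apply: comp_const. Qed.

Lemma comp_negb {E : Type} {EE : Enc E} (a : E -> bool) : computable a -> computable (fun x => ~~ a x).
Proof. by move=> Ha; apply: comp_if => //; apply: comp_const. Qed.

Lemma comp_implyb {E : Type} {EE : Enc E} (a b : E -> bool) : computable a -> computable b ->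
  computable (fun x => a x ==> b x).
Proof. by move=> Ha Hb; apply: comp_if => //; apply: comp_const. Qed.

Ltac comp_bool :=
  lazymatch goal with
  | |- computable (fun x => (@?f x) && (@?g x)) => simple refine (comp_andb (a := f) (b := g) _ _)
  | |- computable (fun x => (@?f x) || (@?g x)) => simple refine (comp_orb (a := f) (b := g) _ _)
  | |- computable (fun x => ~~ (@?f x)) => simple refine (comp_negb (a := f) _)
  | |- computable (fun x => (@?f x) ==> (@?g x)) => simple refine (comp_implyb (a := f) (b := g) _ _)
  end.
Ltac comp_more ::= comp_bool.

(** * Arithmetic and list operations *)

Lemma comp_addn {E : Type} {EE : Enc E} (m n : E -> nat) : computable m -> computable n ->
  computable (fun x => m x + n x).
Proof.
move=> Hm Hn; apply: (@comp_ext _ _ _ _ _ (fun x => iter (m x) succn (n x))).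
  by move=> x; elim: (m x) => //= k <-; rewrite addSn.
by apply: (comp_iter (f := fun _ => succn)) => //; comp.
Qed.

Lemma comp_leq {E : Type} {EE : Enc E} (m n : E -> nat) : computable m -> computable n ->
  computable (fun x => m x <= n x).
Proof.
move=> Hm Hn; apply: (@comp_ext _ _ _ _ _ (fun x => iter (n x) predn (m x) == 0)).
  by move=> x; rewrite iter_predn.
apply: (comp_eq enc_nat_inj); last exact: comp_const.
by apply: (comp_iter (f := fun _ => predn)) => //; comp.
Qed.

Lemma comp_map {E : Type} {EE : Enc E} A B {EA : Enc A} {EB : Enc B} (l : E -> seq A) (f : E -> A -> B) :
  computable l -> computable (fun x : E * A => f x.1 x.2) ->
  computable (fun x => map (f x) (l x)).
Proof.
move=> Hl Hf; apply: (comp_foldr (f := fun x a s => f x a :: s)) => //; first exact: comp_const.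
by comp.
Qed.

Lemma comp_filter {E : Type} {EE : Enc E} A {EA : Enc A} (l : E -> seq A) (f : E -> A -> bool) :
  computable l -> computable (fun x : E * A => f x.1 x.2) ->
  computable (fun x => seq.filter (f x) (l x)).
Proof.
move=> Hl Hf; apply: (comp_foldr (f := fun x a s => if f x a then a :: s else s)) => //.
  exact: comp_const.
by comp.
Qed.

Lemma comp_has {E : Type} {EE : Enc E} A {EA : Enc A} (l : E -> seq A) (f : E -> A -> bool) :
  computable l -> computable (fun x : E * A => f x.1 x.2) ->
  computable (fun x => has (f x) (l x)).
Proof.
move=> Hl Hf; apply: (comp_foldr (f := fun x a b => f x a || b)) => //; first exact: comp_const.
by comp.
Qed.

Lemma comp_all {E : Type} {EE : Enc E} A {EA : Enc A} (l : E -> seq A) (f : E -> A -> bool) :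
  computable l -> computable (fun x : E * A => f x.1 x.2) ->
  computable (fun x => all (f x) (l x)).
Proof.
move=> Hl Hf; apply: (comp_foldr (f := fun x a b => f x a && b)) => //; first exact: comp_const.
by comp.
Qed.

Lemma comp_count {E : Type} {EE : Enc E} A {EA : Enc A} (l : E -> seq A) (f : E -> A -> bool) :
  computable l -> computable (fun x : E * A => f x.1 x.2) ->
  computable (fun x => count (f x) (l x)).
Proof.
move=> Hl Hf.
apply: (@comp_ext _ _ _ _ _ (fun x => foldr (fun a n => if f x a then n.+1 else n) 0 (l x))).
  by move=> x; elim: (l x) => //= a s ->; case: (f x a).
apply: (comp_foldr (f := fun x a n => if f x a then n.+1 else n)) => //; first exact: comp_const.
by comp.
Qed.

Lemma comp_size {E : Type} {EE : Enc E} A {EA : Enc A} (l : E -> seq A) :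
  computable l -> computable (fun x => size (l x)).
Proof.
move=> Hl; apply: (@comp_ext _ _ _ _ _ (fun x => count xpredT (l x))).
  by move=> x; rewrite count_predT.
by apply: (comp_count (f := fun _ _ => true)) => //; comp.
Qed.

Lemma comp_cat {E : Type} {EE : Enc E} A {EA : Enc A} (l t : E -> seq A) :
  computable l -> computable t -> computable (fun x => l x ++ t x).
Proof.
move=> Hl Ht; apply: (@comp_ext _ _ _ _ _ (fun x => foldr cons (t x) (l x))).
  by move=> x; elim: (l x) => //= a s ->.
by apply: (comp_foldr (f := fun _ => cons)) => //; comp.
Qed.

Lemma comp_flatten {E : Type} {EE : Enc E} A {EA : Enc A} (l : E -> seq (seq A)) :
  computable l -> computable (fun x => flatten (l x)).
Proof.
move=> Hl; apply: (comp_foldr (f := fun _ => cat)) => //; first exact: comp_const.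
cbv beta; by apply: comp_cat; comp.
Qed.

(** The state of the fold is the unread part of the second list and the result in reverse order;
    nothing is added once that list is exhausted. *)
Lemma comp_zip {E : Type} {EE : Enc E} A B {EA : Enc A} {EB : Enc B} (l : E -> seq A) (t : E -> seq B) :
  computable l -> computable t -> computable (fun x => zip (l x) (t x)).
Proof.
move=> Hl Ht.
pose step (st : seq B * seq (A * B)) a :=
  if st.1 is b :: t' then (t', (a, b) :: st.2) else ([::], st.2).
apply: (@comp_ext _ _ _ _ _ (fun x => rev (foldl step (t x, [::]) (l x)).2)).
  have H u v w : (foldl step (v, w) u).2 = rev (zip u v) ++ w.
    elim: u v w => [|a u IH] [|b v] w //=; first by rewrite IH; case: (u).
    by rewrite IH rev_cons cat_rcons.
  by move=> x; rewrite H cats0 revK.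
apply: comp_rev; apply: comp_snd; apply: (comp_foldl (f := fun _ => step)) => //; first by comp.
apply: (comp_seq_case (g := fun (x : E * (seq B * seq (A * B)) * A) b t' =>
  (t', (x.2, b) :: x.1.2.2))); by comp.
Qed.

Ltac comp_list :=
  lazymatch goal with
  | |- computable (fun x => (@?f x) + (@?g x)) => simple refine (comp_addn (m := f) (n := g) _ _)
  | |- computable (fun x => (@?f x) <= (@?g x)) => simple refine (comp_leq (m := f) (n := g) _ _)
  | |- computable (fun x => map (@?f x) (@?l x)) => simple refine (comp_map (f := f) (l := l) _ _)
  | |- computable (fun x => seq.filter (@?f x) (@?l x)) => simple refine (comp_filter (f := f) (l := l) _ _)
  | |- computable (fun x => has (@?f x) (@?l x)) => simple refine (comp_has (f := f) (l := l) _ _)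
  | |- computable (fun x => all (@?f x) (@?l x)) => simple refine (comp_all (f := f) (l := l) _ _)
  | |- computable (fun x => count (@?f x) (@?l x)) => simple refine (comp_count (f := f) (l := l) _ _)
  | |- computable (fun x => size (@?l x)) => simple refine (comp_size (l := l) _)
  | |- computable (fun x => rev (@?l x)) => simple refine (comp_rev (l := l) _)
  | |- computable (fun x => (@?l x) ++ (@?t x)) => simple refine (comp_cat (l := l) (t := t) _ _)
  | |- computable (fun x => flatten (@?l x)) => simple refine (comp_flatten (l := l) _)
  | |- computable (fun x => zip (@?l x) (@?t x)) => simple refine (comp_zip (l := l) (t := t) _ _)
  end.
Ltac comp_more ::= first [comp_bool | comp_list].

#[local] Hint Resolve enc_nat_inj enc_perm_inj : core.

Lemma comp_mem {E : Type} {EE : Enc E} (A : eqType) {EA : Enc A} (l : E -> seq A)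
    (a : E -> A) : injective EA ->
  computable l -> computable a -> computable (fun x => a x \in l x).
Proof.
move=> injA Hl Ha; apply: (@comp_ext _ _ _ _ _ (fun x => has (fun b => b == a x) (l x))).
  by move=> x; rewrite has_pred1.
by comp; apply: (comp_eq injA); comp.
Qed.

Lemma comp_undup {E : Type} {EE : Enc E} (A : eqType) {EA : Enc A} (l : E -> seq A) :
  injective EA -> computable l -> computable (fun x => undup (l x)).
Proof.
move=> injA Hl; apply: (@comp_ext _ _ _ _ _
    (fun x => foldr (fun a s => if a \in s then s else a :: s) [::] (l x))).
  by move=> x; elim: (l x) => //= a s <-; rewrite mem_undup.
apply: (comp_foldr (f := fun _ a s => if a \in s then s else a :: s)) => //; comp.
by apply: (comp_mem injA); comp.
Qed.

Lemma comp_subs {E : Type} {EE : Enc E} A {EA : Enc A} (l : E -> seq A) :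
  computable l -> computable (fun x => subs (l x)).
Proof.
move=> Hl; apply: (@comp_ext _ _ _ _ _
    (fun x => foldr (fun a s => map (cons a) s ++ s) [:: [::]] (l x))).
  by move=> x; elim: (l x) => //= a s <-.
by apply: (comp_foldr (f := fun _ a s => map (cons a) s ++ s)) => //; comp.
Qed.

Lemma comp_cart {E : Type} {EE : Enc E} A {EA : Enc A} (l : E -> seq (seq A)) :
  computable l -> computable (fun x => cart (l x)).
Proof.
move=> Hl; apply: (@comp_ext _ _ _ _ _
    (fun x => foldr (fun l c => flatten [seq [seq a :: t | t <- c] | a <- l]) [:: [::]] (l x))).
  by move=> x; elim: (l x) => //= a s <-.
by apply: (comp_foldr (f := fun _ l c => flatten [seq [seq a :: t | t <- c] | a <- l])) => //; comp.
Qed.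

Lemma comp_word {E : Type} {EE : Enc E} (p : E -> permutation) :
  computable p -> computable (fun x => word (p x)).
Proof. by []. Qed.

Lemma comp_perm_of_word {E : Type} {EE : Enc E} (p : E -> permutation) :
  computable (fun x => word (p x)) -> computable p.
Proof. by []. Qed.

(** Replaces the subtype test hidden in [std] by list operations: it succeeds exactly on nonempty
    words without repetition. *)
Lemma word_std_if w : word (std w) = if (undup w == w) && (w != [::]) then stdw w else [:: 1].
Proof.
case: andP => [[/eqP u w0]|n]; first by rewrite word_std // -u undup_uniq.
rewrite /std -[word _]/(val _) val_insubd; case: ifP => // pw; case: n; split.
  by apply/eqP/undup_id/(map_uniq (f := rank w))/uniq_perm_word.
by case/andP: pw => + _; rewrite -!size_eq0 size_map.
Qed.

Lemma comp_std {E : Type} {EE : Enc E} (w : E -> seq nat) :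
  computable w -> computable (fun x => std (w x)).
Proof.
move=> Hw; apply: comp_perm_of_word.
apply: (@comp_ext _ _ _ _ _ (fun x =>
  if (undup (w x) == w x) && (w x != [::]) then stdw (w x) else [:: 1])).
  by move=> x; apply: word_std_if.
rewrite /stdw /rank; comp.
- by apply: (comp_eq (enc_seq_inj enc_nat_inj)); comp; apply: (comp_undup enc_nat_inj); comp.
- by apply: (comp_eq (enc_seq_inj enc_nat_inj)); comp.
Qed.

Ltac comp_algo :=
  lazymatch goal with
  | |- computable (fun x => subs (@?l x)) => simple refine (comp_subs (l := l) _)
  | |- computable (fun x => cart (@?l x)) => simple refine (comp_cart (l := l) _)
  | |- computable (fun x => std (@?w x)) => simple refine (comp_std (w := w) _)
  | |- computable (fun x => word (@?p x)) => simple refine (comp_word (p := p) _)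
  | |- computable (fun x => undup (@?l x)) =>
      simple refine (comp_undup (l := l) _ _); first exact enc_perm_inj
  | |- computable (fun x => in_mem (@?a x) (mem (@?l x))) =>
      simple refine (comp_mem (l := l) (a := a) enc_perm_inj _ _)
  end.
Ltac comp_more ::= first [comp_bool | comp_list | comp_algo].

(** * Computability of the specification *)

Lemma comp_compat {E : Type} {EE : Enc E} (r : E -> seq nat) (Ss : E -> seq (seq nat)) :
  computable r -> computable Ss -> computable (fun x => compat (r x) (Ss x)).
Proof.
move=> Hr HS; rewrite /compat.
apply: (@comp_ext _ _ _ _ _ (fun x =>
  all (fun u => all (fun v => (u.1 < v.1) ==> all (fun a => all (fun b => a < b) v.2) u.2)
    (zip (r x) (Ss x))) (zip (r x) (Ss x)))) => //.
by comp.
Qed.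

Lemma comp_pats {E : Type} {EE : Enc E} (p : E -> permutation) :
  computable p -> computable (fun x => pats (p x)).
Proof.
move=> Hp; rewrite /pats; comp.
by apply: (comp_eq (enc_seq_inj enc_nat_inj)); comp.
Qed.

Lemma comp_fits {E : Type} {EE : Enc E} r Ts p : computable r -> computable Ts -> computable p ->
  computable (fun x : E => fits (r x) (Ts x) (p x)).
Proof.
move=> Hr HT Hp; rewrite /fits; comp.
- by apply: (comp_eq (enc_seq_inj enc_nat_inj)); comp.
- by apply: comp_compat; comp.
by apply: (comp_eq (enc_seq_inj enc_nat_inj)); comp.
Qed.

Lemma comp_states {E : Type} {EE : Enc E} Ts e : computable Ts -> computable e ->
  computable (fun x : E => states (Ts x) (e x)).
Proof.
move=> HT He.
pose step (st : nat * seq (nat * seq permutation)) T := (st.1.+1, (st.1, T) :: st.2).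
apply: (@comp_ext _ _ _ _ _
    (fun x => rev (foldl step (start (size (Ts x)) (e x), [::]) (Ts x)).2)).
  have H m T w : (foldl step (m, w) T).2 = rev (zip (iota m (size T)) T) ++ w.
    by elim: T m w => [|a T IH] m w //=; rewrite IH rev_cons cat_rcons.
  by move=> x; rewrite H cats0 revK.
apply: comp_rev; apply: comp_snd; apply: (comp_foldl (f := fun _ => step)) => //; last first.
  by rewrite /step; comp.
by comp; rewrite /start; apply: comp_eps_case; comp.
Qed.

Lemma comp_arg_eps {E : Type} {EE : Enc E} r : computable r ->
  computable (fun x : E => arg_eps (r x)).
Proof.
by move=> Hr; rewrite /arg_eps; comp; apply: (comp_eq enc_perm_inj); comp.
Qed.

Lemma comp_some {E : Type} {EE : Enc E} (f : E -> permutation * seq nat) :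
  computable f -> computable (fun x => Some (f x)).
Proof. by move=> [p Hp]; exists p => a; move: (Hp a); case: (f a). Qed.

Lemma comp_to_term {E : Type} {EE : Enc E} k : computable k ->
  computable (fun x : E => to_term (k x)).
Proof. by []. Qed.

Lemma comp_restriction {E : Type} {EE : Enc E} e A C :
  computable e -> computable A -> computable C ->
  computable (fun x : E => Restriction (e x) (A x) (C x)).
Proof. by move=> He HA HC; apply: (comp_pair He (comp_pair HA HC)). Qed.

Lemma comp_equation {E : Type} {EE : Enc E} l r : computable l -> computable r ->
  computable (fun x : E => Equation (l x) (r x)).
Proof. by move=> Hl Hr; apply: (comp_pair Hl Hr). Qed.

Lemma comp_root_candidates {E : Type} {EE : Enc E} P Ts r :
  computable P -> computable Ts -> computable r ->
  computable (fun x : E => root_candidates (P x) (Ts x) (r x)).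
Proof.
move=> HP HT Hr; rewrite /root_candidates; comp.
- by apply: comp_arg_eps; comp.
- by apply: comp_states; comp.
- by apply: comp_some; comp.
by apply: comp_fits; comp.
Qed.

Lemma comp_candidates {E : Type} {EE : Enc E} S P Ts e :
  computable S -> computable P -> computable Ts -> computable e ->
  computable (fun x : E => candidates (S x) (P x) (Ts x) (e x)).
Proof.
move=> HS HP HT He; rewrite /candidates; comp.
- by apply: (comp_eq enc_perm_inj); comp.
- by rewrite /root_list; comp; apply: comp_eps_case; comp.
by apply: comp_root_candidates; comp.
Qed.

Lemma comp_spec_with {E : Type} {EE : Enc E} B S P Ts :
  computable B -> computable S -> computable P -> computable Ts ->
  computable (fun x : E => spec_with (B x) (S x) (P x) (Ts x)).
Proof.
move=> HB HS HP HT; rewrite /spec_with /union_equation /state_equation.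
have injT := enc_seq_inj enc_perm_inj.
comp.
- apply: comp_equation; first by apply: comp_restriction; comp.
  by comp; [apply: comp_candidates; comp|apply: comp_to_term; comp].
all: by apply: comp_equation; [apply: comp_restriction; comp|
  comp; [apply: comp_candidates; comp|apply: (comp_eq injT); comp|apply: comp_to_term; comp]].
Qed.

Lemma comp_spec_of :
  computable (fun x : seq permutation * seq permutation => spec_of x.1 x.2).
Proof.
rewrite /spec_of /safe_types /patterns; apply: comp_spec_with; comp.
all: apply: comp_pats; comp.
Qed.

Local Open Scope ring_scope.

Theorem mainTheorem1 :
  exists algo : program,
    forall B S : seq permutation,
      antichain B ->
      Av B p12 -> Av B p21 ->
      (forall s : permutation, s \in S <-> simple_perm s /\ Av B s) ->
      exists sp : specification,
        [/\ run algo (enc_input B S) (enc_specification sp),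
            comb_specification (Av B) B S sp,
            positive_system (gf_system sp) /\
            satisfies (fun i => gen_fun (spec_set (Av B) sp i)) (gf_system sp)
          & forall (R : realType) (x : R),
              0 < x -> (gf_value (Av B) x < +oo)%E ->
              boltzmann_sampler (Av B) sp x].
Proof.
have [algo Halgo] := comp_spec_of.
exists algo => B S _ _ _ HS; have comb := comb_specification_spec_of HS.
(* The generic encodings of pairs and lists unfold to [enc_input] and [enc_specification]. *)
exists (spec_of B S); split=> //; first exact: (Halgo (B, S)).
  split; [exact: gf_system_positive|exact: gf_system_satisfied comb].
move=> R x x0 fin; have [[sp0 X0] _ _ _ _] := comb.
apply: (boltzmann_sampler_spec comb) => // [r /HS[[r4 _] _]|i hi].
  exact: leq_trans r4.
exact: spec_set_sub hi.
Qed.
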